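(* There are no complete spacelike hypersurfaces of non-positive constant mean curvature bounded away from future infinity in the $(m+1)$-dimensional Einstein-de Sitter spacetime $\mathbb{R}^+\times_{t^{2/3}}\mathbb{R}^m$.
   Context: Here $m\ge 2$, $\mathbb{R}^+=(0,+\infty)$, and $\mathbb{R}^+\times_{t^{2/3}}\mathbb{R}^m$ is $\overline{M}=\mathbb{R}^+\times\mathbb{R}^m$ with the Lorentzian metric $\overline{g}=-dt^2+t^{4/3}g_0$, where $g_0$ is the Euclidean metric on $\mathbb{R}^m$ (warped product with warping function $\rho(t)=t^{2/3}$), time-oriented by $\partial_t$. A spacelike hypersurface is an immersion $\psi:M\to\overline{M}$ of an $m$-dimensional manifold $M$ such that the induced metric $g$ on $M$ is Riemannian; it is complete if $(M,g)$ is complete. Let $N$ be the unique globally defined unit timelike normal field along $\psi$ with $\overline{g}(N,\partial_t)\le -1$; the shape operator is $AX=-\overline{\nabla}_XN$, with $\overline{\nabla}$ the Levi-Civita connection of $\overline{g}$, and the mean curvature is $H=-\frac1m\mathrm{trace}(A)$ (so a slice $\{t_0\}\times\mathbb{R}^m$ has $H=\rho'(t_0)/\rho(t_0)$). Let $\tau:M\to\mathbb{R}^+$ be the composition of $\psi$ with the projection onto $\mathbb{R}^+$. The hypersurface is bounded away from future infinity if $\sup_M\tau<+\infty$. *)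

(* Defs.v *)
From mathcomp Require Import all_boot all_order all_algebra.
From mathcomp Require Import all_classical all_reals all_analysis.
Set Implicit Arguments.
Unset Strict Implicit.
Unset Printing Implicit Defensive.
Import Order.TTheory GRing.Theory Num.Theory.
Import numFieldNormedType.Exports.
Local Open Scope classical_set_scope.
Local Open Scope ring_scope.

(* Vectors are rows, and a matrix A
   represents the endomorphism v |-> v *m A. *)

Section smooth_maps.
Context {R : realType}.

(* C^infinity on the open set U: every iterated directional derivative exists
   and is Frechet differentiable at every point of U. *)
Definition smooth_on (V W : normedModType R) (U : set V) (f : V -> W) : Prop :=
  forall (vs : seq V) (x : V), U x ->
    differentiable (foldr (fun (v : V) (g : V -> W) => 'D_v g) f vs) x.

End smooth_maps.

Section manifolds.
Context {R : realType} {m : nat}.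

(* The values of chart_map off chart_dom and of chart_inv off chart_cod are
   irrelevant. *)
Record chart (M : topologicalType) := Chart {
  chart_dom : set M ;
  chart_cod : set 'rV[R]_m ;
  chart_map :> M -> 'rV[R]_m ;
  chart_inv : 'rV[R]_m -> M ;
  chart_dom_open : open chart_dom ;
  chart_cod_open : open chart_cod ;
  chart_map_cod : forall p, chart_dom p -> chart_cod (chart_map p) ;
  chart_inv_dom : forall x, chart_cod x -> chart_dom (chart_inv x) ;
  chart_mapK : forall p, chart_dom p -> chart_inv (chart_map p) = p ;
  chart_invK : forall x, chart_cod x -> chart_map (chart_inv x) = x ;
  chart_map_cts : forall p, chart_dom p -> {for p, continuous chart_map} ;
  chart_inv_cts : forall x, chart_cod x -> {for x, continuous chart_inv} }.

End manifolds.
Arguments chart R m M : clear implicits.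

(* Nonempty by convention; connectedness is not required. *)
Record smooth_manifold (R : realType) (m : nat) := SmoothManifold {
  carrier :> topologicalType ;
  atlas : set (chart R m carrier) ;
  manifold_nonempty : [set: carrier] !=set0 ;
  manifold_hausdorff : hausdorff_space carrier ;
  manifold_second_countable : @second_countable carrier ;
  atlas_cover : forall p : carrier, exists2 c, atlas c & chart_dom c p ;
  atlas_compatible : forall c c' : chart R m carrier, atlas c -> atlas c' ->
    smooth_on (chart_cod c `&` [set x | chart_dom c' (chart_inv c x)])
              (c' \o chart_inv c) }.

Section coordinate_metrics.
Context {R : realType} {n : nat}.
Implicit Types (G : 'rV[R]_n -> 'M[R]_n) (x u v : 'rV[R]_n).

(* G is the matrix field of a pseudo-Riemannian metric in global coordinates
   on an open subset of R^n. *)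
Definition inner G x u v : R := (u *m G x *m v^T) 0 0.

Definition partial (i : 'I_n) (f : 'rV[R]_n -> R) x : R :=
  'D_(delta_mx 0 i) f x.

(* Coefficients Gamma^k_{ij} of the Levi-Civita connection of G. *)
Definition christoffel G x (k i j : 'I_n) : R :=
  2^-1 * \sum_l invmx (G x) k l *
    (partial i (fun y => G y j l) x + partial j (fun y => G y i l) x
     - partial l (fun y => G y i j) x).

(* Covariant derivative, in the direction v, of the vector field W along phi. *)
Definition covariant_derivative (m : nat) G (phi W : 'rV[R]_m -> 'rV[R]_n)
    (x v : 'rV[R]_m) : 'rV[R]_n :=
  'D_v W x + \row_k \sum_i \sum_j
    christoffel G (phi x) k i j * ('D_v phi x) 0 i * W x 0 j.

End coordinate_metrics.

Section hypersurfaces.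
Context {R : realType} {m n : nat} {M : smooth_manifold R m}.
Implicit Types (G : 'rV[R]_n -> 'M[R]_n) (psi N : M -> 'rV[R]_n).

Definition smooth_map psi : Prop :=
  forall c, atlas c -> smooth_on (chart_cod c) (psi \o chart_inv c).

Definition immersion psi : Prop :=
  smooth_map psi /\
  forall c x, atlas c -> chart_cod c x ->
    injective ('d (psi \o chart_inv c) x).

(* The metric induced by psi, in the coordinates of the chart c. *)
Definition induced_metric G psi (c : chart R m M) (x u v : 'rV[R]_m) : R :=
  inner G (psi (chart_inv c x))
    ('d (psi \o chart_inv c) x u) ('d (psi \o chart_inv c) x v).

Definition induced_metric_riemannian G psi : Prop :=
  forall c x v, atlas c -> chart_cod c x -> v != 0 ->
    0 < induced_metric G psi c x v v.

Definition C1_curve (gamma : R -> M) : Prop :=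
  continuous gamma /\
  forall (c : chart R m M) t, atlas c -> chart_dom c (gamma t) ->
    derivable (c \o gamma) t 1 /\ {for t, continuous ((c \o gamma)^`())%classic}.

(* Length of gamma on [0, 1] for the induced metric: since that metric is the
   pullback by psi, g(gamma', gamma') is the ambient square of (psi o gamma)'. *)
Definition curve_length G psi (gamma : R -> M) : \bar R :=
  (\int[lebesgue_measure]_(t in `[0%R, 1%R])
    (Num.sqrt (inner G (psi (gamma t))
       ((psi \o gamma)^`()%classic t) ((psi \o gamma)^`()%classic t)))%:E)%E.

(* Riemannian distance of the induced metric, +oo between distinct components.
   Reparametrizing so that the velocity vanishes at the break points and end
   points turns a piecewise C^1 curve on [0, 1] into a C^1 curve on R of the
   same length, hence these curves yield the usual infimum. *)
Definition induced_dist G psi (p q : M) : \bar R :=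
  ereal_inf [set curve_length G psi gamma | gamma in
    [set gamma | [/\ C1_curve gamma, gamma 0 = p & gamma 1 = q]]].

Definition induced_complete G psi : Prop :=
  forall u : nat -> M,
    (forall e : R, 0 < e -> exists k : nat, forall i j : nat,
      (k <= i)%N -> (k <= j)%N -> (induced_dist G psi (u i) (u j) < e%:E)%E) ->
    exists p : M, forall e : R, 0 < e -> exists k : nat, forall i : nat,
      (k <= i)%N -> (induced_dist G psi (u i) p < e%:E)%E.

(* N is a smooth unit timelike normal field along psi. *)
Definition unit_timelike_normal G psi N : Prop :=
  [/\ smooth_map N,
      (forall p, inner G (psi p) (N p) (N p) = -1) &
      forall c x v, atlas c -> chart_cod c x ->
        inner G (psi (chart_inv c x)) (N (chart_inv c x))
          ('d (psi \o chart_inv c) x v) = 0].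

(* A is the matrix, in the coordinate basis of c at p, of the shape operator
   X |-> - nabla_X N; tangent vectors are identified with their images by the
   differential of psi. *)
Definition shape_operator G psi N (c : chart R m M) (p : M) (A : 'M[R]_m) :
    Prop :=
  forall v : 'rV[R]_m,
    'd (psi \o chart_inv c) (c p) (v *m A) =
    - covariant_derivative G (psi \o chart_inv c) (N \o chart_inv c) (c p) v.

Definition has_mean_curvature G psi N (p : M) (h : R) : Prop :=
  forall c, atlas c -> chart_dom c p ->
    exists2 A, shape_operator G psi N c p A & h = - (m%:R^-1 * \tr A).

End hypersurfaces.

Section warped_products.
Context {R : realType} {m : nat}.

(* Points of R x R^m are rows of length m.+1, coordinate 0 being the time t. *)
Definition time (x : 'rV[R]_m.+1) : R := x 0 0.

Definition dt : 'rV[R]_m.+1 := delta_mx 0 0.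

(* - dt^2 + rho(t)^2 g_0 *)
Definition warped_metric (rho : R -> R) (x : 'rV[R]_m.+1) : 'M[R]_m.+1 :=
  \matrix_(i, j)
    if i == j then (if i == 0 then -1 else rho (time x) ^+ 2) else 0.

Definition eds_metric : 'rV[R]_m.+1 -> 'M[R]_m.+1 :=
  warped_metric (fun t => t `^ (2 / 3)).

Definition eds_spacetime : set 'rV[R]_m.+1 := [set x | 0 < time x].

Definition eds_spacelike_hypersurface (M : smooth_manifold R m)
    (psi : M -> 'rV[R]_m.+1) : Prop :=
  [/\ (forall p, eds_spacetime (psi p)), immersion psi &
      induced_metric_riemannian eds_metric psi].

Definition eds_gauss_map (M : smooth_manifold R m)
    (psi N : M -> 'rV[R]_m.+1) : Prop :=
  unit_timelike_normal eds_metric psi N /\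
  forall p, inner eds_metric (psi p) (N p) dt <= -1.

Definition bounded_away_from_future_infinity (M : smooth_manifold R m)
    (psi : M -> 'rV[R]_m.+1) : Prop :=
  has_ubound (range (time \o psi)).

End warped_products.

(* Main.v *)
Require Import Defs.
From mathcomp Require Import all_boot all_order all_algebra.
From mathcomp Require Import all_classical all_reals all_analysis.
From mathcomp Require Import ring lra measurable_realfun.
Set Implicit Arguments.
Unset Strict Implicit.
Unset Printing Implicit Defensive.
Import Order.TTheory GRing.Theory Num.Theory.
Import numFieldNormedType.Exports.
Local Open Scope classical_set_scope.
Local Open Scope ring_scope.

(* Let F be the spatial part of the immersion, tau its time, and put
   Phi = 3 tau^(1/3) + sqrt (r^2 + |F - y|^2). If Phi has a local minimum at p,
   then its first variation expresses the unit normal through the gradient of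
   the space term, and its second variation in a tangent direction v becomes
   0 <= (1/s - rho') (|v_s|^2 - <b, v_s>^2) - g(Av, v) / (rho n_0), where
   rho = tau^(2/3), s = sqrt (r^2 + |F - y|^2), b = (F - y) / s, v_s is the
   spatial part of v and n_0 >= 1 is the time component of the normal. Since tau
   is bounded, 1/s < rho' for large r, so g(Av, v) < 0 for all v != 0 and
   tr A < 0, that is H > 0.
   The minimum exists because F is a local diffeomorphism and g <= rho^2 |dF|^2:
   by completeness F has sections over arbitrarily large balls around y = F p0,
   and Phi exceeds Phi p0 outside a large ball. The image of a section is open
   in M, so a minimum over the ball is a local minimum on M. *)

(** * The barrier at a point of contact *)

(** A slice is the natural barrier, but [tau] need not attain its infimum on a noncompact
    hypersurface. The term sqrt (r^2 + |F - y|^2) makes the barrier grow in every spatial direction,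
    and its gradient in F has length < 1, so that the level sets are spacelike. In the conformal
    time 3 t^(1/3) these are lower sheets of Minkowski hyperboloids of radius r, whose bending 1/s
    <= 1/r competes with the expansion rho' = (2/3) t^(-1/3). Since rho' decays, only an upper bound
    on [tau] allows one r to serve at every possible contact point; the same bound controls rho in
    the comparison of g with |dF|^2. F is never shown to be a covering map: sections over balls
    suffice, and they are continued radially, completeness providing the limits at the boundary.
    Completeness is stated through infima of lengths of curves, so two estimates link it to the
    topology of M: lifted segments have length at most C times that of the segment, and a curve that
    reaches p from outside a neighbourhood of p has length bounded below. *)

Section negative_trace.
Context {R : realFieldType} {m : nat}.

Lemma dot_sum (u v : 'rV[R]_m) : (u *m v^T) 0 0 = \sum_i u 0 i * v 0 i.
Proof. by rewrite mxE; apply: eq_bigr => i _; rewrite mxE. Qed.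

Lemma trace_sum_delta (Q : 'M[R]_m) :
  \tr Q = \sum_i ((delta_mx 0 i : 'rV_m) *m Q *m (delta_mx 0 i : 'rV_m)^T) 0 0.
Proof.
apply: eq_bigr => i _.
by rewrite -rowE trmx_delta -colE !mxE.
Qed.

Lemma trace_neg_form (Q : 'M[R]_m) : (0 < m)%N ->
  (forall w : 'rV[R]_m, w != 0 -> (w *m Q *m w^T) 0 0 < 0) -> \tr Q < 0.
Proof.
move=> m0 Qneg; rewrite trace_sum_delta.
have dn (i : 'I_m) : (delta_mx 0 i : 'rV[R]_m) != 0.
  by apply/eqP => /rowP/(_ i)/eqP; rewrite !mxE !eqxx oner_eq0.
rewrite -subr_gt0 sub0r -sumrN (bigD1 (Ordinal m0)) //=; apply: ltr_pwDl.
  by rewrite oppr_gt0 Qneg.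
by apply: sumr_ge0 => i _; rewrite oppr_ge0; apply/ltW/Qneg.
Qed.

(* In the coordinates given by P the Gram matrix is, up to a positive factor,
   1 - b^T b, whose inverse 1 + b^T b / (1 - |b|^2) is a sum of rank one
   matrices; A times the Gram matrix has a negative quadratic form. *)
Lemma trace_lt0 (A P : 'M[R]_m) (b : 'rV[R]_m) : (0 < m)%N ->
  P \in unitmx -> (b *m b^T) 0 0 < 1 ->
  (forall v : 'rV[R]_m, v != 0 ->
     (v *m A *m P *m (1%:M - b^T *m b) *m P^T *m v^T) 0 0 < 0) ->
  \tr A < 0.
Proof.
move=> m0 uP b1 neg.
set k := (b *m b^T) 0 0 in b1.
have k1 : 1 - k != 0 by lra.
pose B := invmx P *m A *m P.
pose Q := B *m (1%:M - b^T *m b).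
have trB : \tr B = \tr A by rewrite /B mxtrace_mulC mulmxA mulmxV // mul1mx.
have Qneg (w : 'rV[R]_m) : w != 0 -> (w *m Q *m w^T) 0 0 < 0.
  move=> w0; have := neg (w *m invmx P) _.
  have PP : P^T *m (invmx P)^T = 1%:M by rewrite -trmx_mul mulVmx // trmx1.
  rewrite trmx_mul !mulmxA -(mulmxA _ P^T) PP mulmx1.
  apply; apply: contra_neq w0 => w0.
  by rewrite -(mulmxKV uP w) w0 mul0mx.
have bb : b *m b^T = k%:M by rewrite [LHS]mx11_scalar.
have inv : (1%:M - b^T *m b) *m (1%:M + (1 - k)^-1 *: (b^T *m b)) = 1%:M.
  rewrite mulmxDr mulmx1 -scalemxAr mulmxBl mul1mx.
  rewrite mulmxA -(mulmxA b^T b) bb mul_mx_scalar -scalemxAl -{2}[b^T *m b]scale1r -scalerBl.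
  by rewrite scalerA mulVf // scale1r subrK.
rewrite -trB -[B]mulmx1 -inv mulmxA -/Q mulmxDr mulmx1 mxtraceD.
rewrite -scalemxAr mxtraceZ [\tr (_ *m (_ *m _))]mxtrace_mulC -mulmxA.
rewrite [\tr (b^T *m _)]mxtrace_mulC.
have t1 : \tr Q < 0 by exact: trace_neg_form.
have t2 : \tr (b *m Q *m b^T) <= 0.
  rewrite /mxtrace big_ord1; have [->|/Qneg/ltW//] := eqVneq b 0.
  by rewrite mul0mx mul0mx mxE.
have : 0 < (1 - k)^-1 by rewrite invr_gt0; lra.
by nra.
Qed.

End negative_trace.

(** * Derivatives along lines and the second derivative test *)

Section derivative_estimates.
Context {R : realType} {V W : normedModType R}.
Implicit Types (f : V -> W) (x v : V) (l : W).

(** Multiplying the difference quotient by [h] removes the punctured neighbourhood: the estimate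
    also covers [h = 0]. In this form derivatives are transported between lines, scaled and lifted
    without handling limits. *)
Lemma is_derive_le f x v l : is_derive x v f l <->
  (forall e : R, 0 < e -> exists2 d : R, 0 < d & forall h : R, `|h| < d ->
     `|f (h *: v + x) - f x - h *: l| <= e * `|h|).
Proof.
split=> [[dfx fl] e e0|H].
  have /cvgrPdist_lt/(_ e e0)[d /= d0 Hd] :
      h^-1 *: (f (h *: v + x) - f x) @[h --> 0^'] --> l.
    rewrite -fl /derive; exact: dfx.
  exists d => // h hd; have [->|h0] := eqVneq h 0.
    by rewrite !scale0r add0r subrr subr0 !normr0 mulr0.
  have := Hd h; rewrite /= sub0r normrN => /(_ hd h0).
  have hn0 : 0 < `|h| by rewrite normr_gt0.
  move=> /ltW; rewrite -(ler_pM2r hn0); apply: le_trans.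
  rewrite [leRHS]mulrC -normrZ scalerBr scalerA mulfV // scale1r.
  by rewrite -normrN opprB.
have c : h^-1 *: (f (h *: v + x) - f x) @[h --> 0^'] --> l.
  apply/cvgrPdist_le => e e0; have [d d0 Hd] := H e e0.
  exists d => //= h; rewrite /= sub0r normrN => hd h0.
  have hn0 : 0 < `|h| by rewrite normr_gt0.
  rewrite -(ler_pM2r hn0) [leLHS]mulrC -normrZ scalerBr scalerA mulfV // scale1r.
  by rewrite -normrN opprB; exact: Hd.
by split; [apply/cvg_ex; exists l | apply: cvg_lim].
Qed.

End derivative_estimates.

Section second_derivative_test.
Context {R : realType}.

(** If [l < 0], then [w] is negative just to the right of 0, and the mean value theorem puts [u]
    below [u 0] there. Keeping [w] apart from [u] means that the second derivative is needed at 0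
    only. *)
Lemma second_derivative_test (u w : R -> R) (l : R) :
  (\forall s \near (0 : R), u 0 <= u s) ->
  (\forall s \near (0 : R), is_derive (s : R) (1 : R) u (w s)) ->
  is_derive (0 : R) (1 : R) w l ->
  w 0 = 0 /\ 0 <= l.
Proof.
move=> [d1 /= d10 umin] [d2 /= d20 du] dw.
pose d := Num.min d1 d2.
have d0 : 0 < d by rewrite lt_min d10 d20.
have {}umin (s : R) : `|s| < d -> u 0 <= u s.
  by move=> sd; apply: umin; rewrite /= sub0r normrN (lt_le_trans sd) // ge_min lexx.
have {}du (s : R) : `|s| < d -> is_derive (s : R) (1 : R) u (w s).
  by move=> sd; apply: du; rewrite /= sub0r normrN (lt_le_trans sd) // ge_min lexx orbT.
have w0 : w 0 = 0.
  have d00 : is_derive (0 : R) (1 : R) u (w 0) by apply: du; rewrite normr0.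
  have d01 : is_derive (0 : R) (1 : R) u 0.
    apply: (@derive1_at_min R u (- d) d) => //.
    - by lra.
    - by move=> t; rewrite in_itv /= => td; apply: ex_derive; apply: du; rewrite ltr_norml.
    - by rewrite in_itv /= oppr_lt0 d0.
    - by move=> t; rewrite in_itv /= => td; apply: umin; rewrite ltr_norml.
  by rewrite -(@derive_val _ _ _ _ _ _ _ d00) (@derive_val _ _ _ _ _ _ _ d01).
split=> //; rewrite leNgt; apply/negP => l0.
(* Half of the slope is spent on the error term, which leaves [w s <= l / 2 * s] for small positive
   [s]. *)
have [|e e0 He] := (is_derive_le w 0 1 l).1 dw (- l / 2); first by lra.
have wneg (s : R) : 0 < s -> s < e -> w s < 0.
  move=> s0 se.
  have := He s; rewrite gtr0_norm // => /(_ se).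
  rewrite w0 subr0 /GRing.scale /= mulr1 addr0 ler_norml => /andP[_].
  nra.
pose s := Num.min e d / 2.
have s0 : 0 < s by rewrite divr_gt0 // lt_min e0 d0.
have sm : s < Num.min e d.
  have : 0 < Num.min e d by rewrite lt_min e0 d0.
  by rewrite /s; move: (Num.min e d) => z; lra.
have [se sd] : s < e /\ s < d by move: sm; rewrite lt_min => /andP.
have sbd (t : R) : 0 <= t <= s -> `|t| < d.
  by move=> /andP[t0 ts]; rewrite ger0_norm // (le_lt_trans ts).
have [||c] := @MVT R u w 0 s s0.
- move=> t; rewrite in_itv /= => /andP[t0 ts]; apply/du/sbd.
  by rewrite !ltW.
- apply: derivable_within_continuous => t; rewrite in_itv /= => ts.
  by apply: ex_derive; apply/du/sbd.
rewrite in_itv /= => /andP[c0 cs] us.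
have := umin s (sbd s _); rewrite lexx ltW // => /(_ isT).
have := wneg c c0 (lt_trans cs se).
by move: us; rewrite subr0; nra.
Qed.
End second_derivative_test.

Section real_derivatives.
Context {R : realType}.
Implicit Types (f g : R -> R) (x a b : R).

Lemma is_derive_mul f g x a b : is_derive x 1 f a -> is_derive x 1 g b ->
  is_derive x 1 (fun s => f s * g s) (a * g x + f x * b).
Proof.
move=> df dg; have := is_deriveM df dg.
by rewrite /GRing.scale /= addrC [g x * a]mulrC.
Qed.

Lemma is_derive_const (c x : R) : is_derive x 1 (fun=> c) 0.
Proof. exact: is_derive_cst. Qed.

Lemma is_derive_add f g x a b : is_derive x 1 f a -> is_derive x 1 g b ->
  is_derive x 1 (fun s => f s + g s) (a + b).
Proof. by move=> df dg; exact: is_deriveD. Qed.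

Lemma is_derive_opp f x a : is_derive x 1 f a ->
  is_derive x 1 (fun s => - f s) (- a).
Proof. by move=> df; exact: is_deriveN. Qed.

Lemma is_derive_bigsum n (h : 'I_n -> R -> R) x (dh : 'I_n -> R) :
  (forall i, is_derive x 1 (h i) (dh i)) ->
  is_derive x 1 (fun s => \sum_(i < n) h i s) (\sum_(i < n) dh i).
Proof.
move=> dhi; have := is_derive_sum dhi.
by congr is_derive; apply/funext => s; rewrite fct_sumE.
Qed.

Lemma is_derive_inv f x a : f x != 0 -> is_derive x 1 f a ->
  is_derive x 1 (fun s => (f s)^-1) (- a / f x ^+ 2).
Proof.
move=> fx [df <-]; split; first exact: derivableV.
rewrite (deriveV fx df) /GRing.scale /=.
by rewrite mulrC mulrN mulNr.
Qed.

Lemma is_derive_eq1 f x a b : a = b -> is_derive x 1 f a -> is_derive x 1 f b.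
Proof. by move=> ->. Qed.

Lemma is_derive_sqrt f x a : 0 < f x -> is_derive x 1 f a ->
  is_derive x 1 (fun s => Num.sqrt (f s)) (a / (2 * Num.sqrt (f x))).
Proof.
move=> fx df; rewrite mulrC.
exact: (@is_derive1_comp _ Num.sqrt f _ _ _ (is_derive1_sqrt fx) df).
Qed.

Lemma is_derive_powR f (p x a : R) : 0 < f x -> is_derive x 1 f a ->
  is_derive x 1 (fun s => f s `^ p) (p * f x `^ (p - 1) * a).
Proof.
move=> fx df.
exact: (@is_derive1_comp _ (fun z => z `^ p) f _ _ _ (is_derive1_powR p fx) df).
Qed.

End real_derivatives.

(* t and f i are the time and space coordinates of a curve in the hypersurface,
   n and nu i those of the unit normal along it. *)
Section contact_along_curve.
Context {R : realType} {m : nat}.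
Variables (t t1 n : R -> R) (f f1 nu : 'I_m -> R -> R).
Variables (t2 n' : R) (f2 nu' y : 'I_m -> R) (r : R).
Hypothesis t_gt0 : \forall s \near (0 : R), 0 < t s.
Hypothesis dt : \forall s \near (0 : R), is_derive (s : R) (1 : R) t (t1 s).
Hypothesis df : \forall s \near (0 : R), forall i, is_derive (s : R) (1 : R) (f i) (f1 i s).
Hypothesis dt1 : is_derive (0 : R) (1 : R) t1 t2.
Hypothesis df1 : forall i, is_derive (0 : R) (1 : R) (f1 i) (f2 i).
Hypothesis dn : is_derive (0 : R) (1 : R) n n'.
Hypothesis dnu : forall i, is_derive (0 : R) (1 : R) (nu i) (nu' i).
Hypothesis orth : \forall s \near (0 : R),
  - (n s * t1 s) + (t s `^ (2 / 3)) ^+ 2 * \sum_i nu i s * f1 i s = 0.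
Hypothesis r_gt0 : 0 < r.

Let D s := Num.sqrt (r ^+ 2 + \sum_i (f i s - y i) ^+ 2).
Let u s := 3 * t s `^ (3^-1) + D s.

(** Every power of [t] that occurs is an integer power of [q], so that [field] can close the
    identities below. *)
Let q s := t s `^ (3^-1).
Let q_gt0 s : 0 < t s -> 0 < q s. Proof. exact: powR_gt0. Qed.

Let q2 s : 0 < t s -> t s `^ (2 / 3) = q s ^+ 2.
Proof.
by move=> ts; rewrite -[RHS]powR_mulrn ?powR_ge0 // -powRrM mulrC.
Qed.

Let dq s a : 0 < t s -> is_derive (s : R) (1 : R) t a ->
  is_derive (s : R) (1 : R) q (a / (3 * q s ^+ 2)).
Proof.
move=> ts dts; rewrite /q.
have := is_derive_powR (3^-1) ts dts.
congr is_derive; rewrite -q2 // mulrC; congr (_ * _).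
by rewrite invfM; congr (_ * _); rewrite -powRN; congr (_ `^ _); lra.
Qed.

Let S_gt0 s : 0 < r ^+ 2 + \sum_i (f i s - y i) ^+ 2.
Proof.
by rewrite ltr_pwDl ?exprn_gt0 // sumr_ge0 // => i _; rewrite sqr_ge0.
Qed.

Let D_gt0 s : 0 < D s. Proof. by rewrite sqrtr_gt0 S_gt0. Qed.

Let dD s (a : 'I_m -> R) : (forall i, is_derive (s : R) (1 : R) (f i) (a i)) ->
  is_derive (s : R) (1 : R) D ((\sum_i (f i s - y i) * a i) / D s).
Proof.
move=> da.
have dS : is_derive (s : R) (1 : R) (fun s => r ^+ 2 + \sum_i (f i s - y i) ^+ 2)
    (0 + \sum_i (a i * (f i s - y i) + (f i s - y i) * a i)).
  have dg i := is_derive_add (da i) (is_derive_opp (is_derive_const (y i) s)).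
  have dh i := is_derive_mul (dg i) (dg i).
  have := is_derive_add (is_derive_const (r ^+ 2) s) (is_derive_bigsum dh).
  by apply: is_derive_eq1; congr (_ + _); apply: eq_bigr => i _; rewrite subr0.
have := @is_derive_sqrt _ (fun s => r ^+ 2 + \sum_i (f i s - y i) ^+ 2) s _ (S_gt0 s) dS.
apply: is_derive_eq1; rewrite -/(D s) add0r.
rewrite (_ : \sum_i _ = 2 * \sum_i (f i s - y i) * a i); last first.
  by rewrite mulr_sumr; apply: eq_bigr => i _; ring.
by have := lt0r_neq0 (D_gt0 s); move=> D0; field.
Qed.

(** The derivative of [u]. The factor 3 of the conformal time cancels the 1/3 of [dq], so the first
    summand is the velocity in conformal time. *)
Let w s := t1 s / q s ^+ 2 + (\sum_i (f i s - y i) * f1 i s) / D s.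

Let du : \forall s \near (0 : R), is_derive (s : R) (1 : R) u (w s).
Proof.
near=> s.
have ts : 0 < t s by near: s.
have qs := lt0r_neq0 (q_gt0 ts).
have dts : is_derive (s : R) (1 : R) t (t1 s) by near: s.
have dfs : forall i, is_derive (s : R) (1 : R) (f i) (f1 i s) by near: s.
apply: is_derive_add (dD dfs).
have := is_derive_mul (is_derive_const 3 s) (dq ts dts).
by apply: is_derive_eq1; rewrite mul0r add0r /w /=; field.
Unshelve. all: by end_near. Qed.

(** In the notation of the overview [beta] is <b, v_s> and [X2] is |v_s|^2. *)
Let beta := (\sum_i (f i 0 - y i) * f1 i 0) / D 0.
Let X2 := \sum_i f1 i 0 ^+ 2.
Let nuX := \sum_i nu' i * f1 i 0.

(* g(-nabla_X n, X), where nabla is the Levi-Civita connection of the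
   Einstein-de Sitter metric and X the velocity of the curve. *)
Let alpha := n' * t1 0 - (t 0 `^ (2 / 3)) ^+ 2 * nuX
             - 2 / 3 * t 0 `^ (3^-1) * n 0 * X2.

Hypothesis umin : \forall s \near (0 : R), u 0 <= u s.

Let dw : is_derive (0 : R) (1 : R) w
  (t2 / q 0 ^+ 2 - 2 / 3 * t1 0 ^+ 2 / q 0 ^+ 5
   + (X2 + \sum_i (f i 0 - y i) * f2 i) / D 0 - beta ^+ 2 / D 0).
Proof.
have t0 : 0 < t 0 by exact: (nbhs_singleton t_gt0).
have q0 := lt0r_neq0 (q_gt0 t0); have D0 := lt0r_neq0 (D_gt0 0).
have dt0 := nbhs_singleton dt; have df0 := nbhs_singleton df.
have dq2 : is_derive (0 : R) (1 : R) (fun s => q s ^+ 2) _ :=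
  @is_derive_mul _ q q _ _ _ (dq t0 dt0) (dq t0 dt0).
have dqV := @is_derive_inv _ (fun s => q s ^+ 2) _ _ (expf_neq0 2 q0) dq2.
have dV := @is_derive_inv _ D _ _ D0 (dD df0).
have dg i := is_derive_add (df0 i) (is_derive_opp (is_derive_const (y i) 0)).
have dS := is_derive_bigsum (fun i => is_derive_mul (dg i) (df1 i)).
have := is_derive_add (is_derive_mul dt1 dqV) (is_derive_mul dS dV).
apply: is_derive_eq1.
rewrite (_ : \sum_i (_ + _) = X2 + \sum_i (f i 0 - y i) * f2 i); last first.
  by rewrite -big_split /=; apply: eq_bigr => i _; ring.
rewrite /beta; move: (\sum_i _) X2 => S1 S2; move: (\sum_i _) => S3.
by field; rewrite q0 D0.
Qed.

(** First variation: this is [w 0 = 0] multiplied by [q 0 ^+ 2]. It says that the velocity is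
    tangent to the level set of the barrier. *)
Lemma contact_time_velocity : t1 0 = - (t 0 `^ (2 / 3) * beta).
Proof.
have t0 : 0 < t 0 by exact: (nbhs_singleton t_gt0).
have [w0 _] := second_derivative_test umin du dw.
have q0 := lt0r_neq0 (q_gt0 t0).
move: w0; rewrite /w -/beta q2 // => /eqP; rewrite addr_eq0 => /eqP w0.
by rewrite mulrC -mulNr -w0; field.
Qed.

(** Second variation. The accelerations [t2] and [f2] occur in the second derivative of [u] in the
    same combination as in the differentiated orthogonality relation, because the first premise
    makes the normal proportional to the gradient of the barrier. Eliminating them leaves only
    derivatives of the normal, that is [alpha]. *)
Lemma contact_second_order :
  (forall i, nu i 0 * (t 0 `^ (2 / 3) * D 0) = - (n 0 * (f i 0 - y i))) ->
  0 < n 0 ->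
  alpha <= t 0 `^ (2 / 3) * n 0 * (X2 - beta ^+ 2) *
           ((D 0)^-1 - 2 / (3 * t 0 `^ (3^-1))).
Proof.
move=> nuE n0.
have t0 : 0 < t 0 by exact: (nbhs_singleton t_gt0).
have q0 := q_gt0 t0; have D0 := D_gt0 0.
have q0' := lt0r_neq0 q0; have D0' := lt0r_neq0 D0.
have dt0 := nbhs_singleton dt; have df0 := nbhs_singleton df.
have [_ w1] := second_derivative_test umin du dw.
have X0 := contact_time_velocity.
have dq2 : is_derive (0 : R) (1 : R) (fun s => q s ^+ 2) _ :=
  @is_derive_mul _ q q _ _ _ (dq t0 dt0) (dq t0 dt0).
have dq4 : is_derive (0 : R) (1 : R) (fun s => (q s ^+ 2) ^+ 2) _ :=
  is_derive_mul dq2 dq2.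
have dS := is_derive_bigsum (fun i => is_derive_mul (dnu i) (df1 i)).
have dO := is_derive_add (is_derive_opp (is_derive_mul dn dt1)) (is_derive_mul dq4 dS).
(* The orthogonality relation holds near 0, so its left-hand side has derivative 0; comparison with
   [dO] gives the linear relation that eliminates [t2] and [f2]. *)
have O0 : is_derive (0 : R) (1 : R) (fun s =>
    - (n s * t1 s) + (q s ^+ 2) ^+ 2 * \sum_i nu i s * f1 i s) 0.
  apply: near_eq_is_derive (is_derive_const 0 0).
  near=> s; rewrite -q2; last by near: s.
  by symmetry; near: s.
have {dO O0} := etrans (esym (@derive_val _ _ _ _ _ _ _ dO)) (@derive_val _ _ _ _ _ _ _ O0).
rewrite big_split /= -/nuX.
have SE (g : 'I_m -> R) : \sum_i nu i 0 * g i =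
    - (n 0 / (q 0 ^+ 2 * D 0)) * \sum_i (f i 0 - y i) * g i.
  rewrite mulr_sumr; apply: eq_bigr => i _.
  have := nuE i; rewrite q2 // => e.
  have -> : nu i 0 = - (n 0 * (f i 0 - y i)) / (q 0 ^+ 2 * D 0).
    by rewrite -e; field; rewrite q0' D0'.
  by field; rewrite q0' D0'.
rewrite !SE /alpha X0 !q2 // -/(q 0) => O.
have bE : \sum_i (f i 0 - y i) * f1 i 0 = beta * D 0 by rewrite /beta divfK.
move: O w1; rewrite X0 !q2 // bE.
set F2 := \sum_i _ * f2 i.
move: X2 nuX beta (q 0) (D 0) (n 0) F2 q0 D0 q0' D0' n0 => a2 c b Q d N F q0 D0 q0' D0' n0 O w1.
rewrite -subr_ge0.
(* The second derivative of [u] is multiplied by rho n_0 > 0. Modulo the relation [O] this product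
   is exactly the bound minus [alpha]. *)
have W := mulr_ge0 (mulr_ge0 (ltW (exprn_gt0 2 q0)) (ltW n0)) w1.
apply: le_trans W _; rewrite -subr_ge0 le_eqVlt; apply/orP; left.
by rewrite eq_sym; apply/eqP; rewrite -O; field; rewrite q0' D0'.
Unshelve. all: by end_near. Qed.

End contact_along_curve.

(** * The Levi-Civita connection of the Einstein-de Sitter metric *)

Section inner_products.
Context {R : realType} {n : nat}.
Implicit Types (G : 'rV[R]_n -> 'M[R]_n) (x u v w : 'rV[R]_n).

Lemma inner_sum G x u v :
  inner G x u v = \sum_i \sum_j u 0 i * G x i j * v 0 j.
Proof.
rewrite /inner mxE exchange_big /=; apply: eq_bigr => j _.
by rewrite !mxE big_distrl /=; apply: eq_bigr => i _.
Qed.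

Lemma innerDl G x u v w : inner G x (u + v) w = inner G x u w + inner G x v w.
Proof. by rewrite /inner !mulmxDl mxE. Qed.

Lemma innerNl G x u w : inner G x (- u) w = - inner G x u w.
Proof. by rewrite /inner !mulNmx mxE. Qed.

(* Metric compatibility and the symmetry of the connection leave, in
   g(nabla_a b, a), only the derivative of g in the direction b. *)
Lemma inner_christoffel_diag G x u v : G x \in unitmx ->
  (forall y, (G y)^T = G y) ->
  inner G x (\row_k \sum_i \sum_j christoffel G x k i j * u 0 i * v 0 j) u =
  2^-1 * \sum_j v 0 j *
    \sum_i \sum_l partial j (fun y => G y i l) x * u 0 i * u 0 l.
Proof.
move=> uG symG.
pose d i j l := partial i (fun y => G y j l) x.
have dC i j l : d i j l = d i l j.
  by rewrite /d; congr partial; apply/funext => y; rewrite -[in LHS](symG y) mxE.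
have iC k p : invmx (G x) k p = invmx (G x) p k.
  by rewrite -[in LHS](symG x) -trmx_inv mxE.
(* Contraction with [G] cancels [invmx] and leaves the Christoffel symbols of the first kind. *)
have low i j l : \sum_k christoffel G x k i j * G x k l =
    2^-1 * (d i j l + d j i l - d l i j).
  under eq_bigr => k _ do rewrite /christoffel -mulrA mulr_suml.
  rewrite -mulr_sumr; congr (_ * _).
  rewrite exchange_big /=.
  transitivity (\sum_p (d i j p + d j i p - d p i j) * (1%:M : 'M[R]_n) p l).
    apply: eq_bigr => p _.
    rewrite -(mulVmx uG) mxE mulr_sumr; apply: eq_bigr => k _.
    by rewrite iC /d; ring.
  rewrite (bigD1 l) //= mxE eqxx mulr1 big1 ?addr0 // => p pl.
  by rewrite mxE (negbTE pl) mulr0.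
transitivity (\sum_i \sum_j \sum_l u 0 i * v 0 j * u 0 l *
    (2^-1 * (d i j l + d j i l - d l i j))).
  rewrite inner_sum exchange_big /=.
  under eq_bigr => l _.
    rewrite -big_distrl /=.
    under eq_bigr => k _.
      rewrite mxE big_distrl /=.
      under eq_bigr => i _ do rewrite big_distrl /=.
      over.
    rewrite exchange_big /=.
    under eq_bigr => i _ do rewrite exchange_big /=.
    over.
  under eq_bigr => l _.
    rewrite big_distrl /=.
    under eq_bigr => i _.
      rewrite big_distrl /=.
      under eq_bigr => j _.
        rewrite (_ : _ * u 0 l = u 0 i * v 0 j * u 0 l *
                   (2^-1 * (d i j l + d j i l - d l i j))); last first.
          rewrite -low mulr_suml mulr_sumr; apply: eq_bigr => k _; ring.
        over.
      over.
    over.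
  by rewrite exchange_big /=; apply: eq_bigr => i _; rewrite exchange_big.
rewrite exchange_big mulr_sumr /=; apply: eq_bigr => j _.
(* Against the symmetric product of [u] with itself, the first and the third term of the Christoffel
   symbol both give [S] and cancel; the middle one survives. *)
pose S := \sum_i \sum_l u 0 i * v 0 j * u 0 l * (2^-1 * d i j l).
have S' : \sum_i \sum_l u 0 i * v 0 j * u 0 l * (2^-1 * d l i j) = S.
  rewrite exchange_big /=; apply: eq_bigr => l _; apply: eq_bigr => i _.
  by rewrite dC; ring.
transitivity (S + 2^-1 * (v 0 j * \sum_i \sum_l d j i l * u 0 i * u 0 l) - S); last first.
  by rewrite addrAC subrr add0r.
rewrite -[X in _ - X]S' {1}/S !mulr_sumr -sumrN -!big_split /=; apply: eq_bigr => i _.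
rewrite !mulr_sumr -sumrN -!big_split /=; apply: eq_bigr => l _; rewrite /d; ring.
Qed.

End inner_products.

Section einstein_de_sitter_connection.
Context {R : realType} {m : nat}.
Implicit Types (x u v : 'rV[R]_m.+1).

Lemma inner_warped (rho : R -> R) x u v :
  inner (warped_metric rho) x u v = - (u 0 0 * v 0 0) +
    rho (time x) ^+ 2 * \sum_i u 0 (lift ord0 i) * v 0 (lift ord0 i).
Proof.
rewrite inner_sum (eq_bigr (fun i => u 0 i * warped_metric rho x i i * v 0 i)); last first.
  move=> i _; rewrite (bigD1 i) //= big1 ?addr0 // => j ji.
  by rewrite mxE eq_sym (negbTE ji) mulr0 mul0r.
rewrite big_ord_recl mxE /= mulrN1 mulNr mulr_sumr; congr (_ + _).
by apply: eq_bigr => i _; rewrite mxE eqxx /=; ring.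
Qed.

Lemma tr_warped_metric (rho : R -> R) x :
  (warped_metric rho x)^T = warped_metric rho x.
Proof.
apply/matrixP => i j; rewrite !mxE eq_sym.
by case: eqP => // ->.
Qed.

Lemma warped_metric_unit (rho : R -> R) x : rho (time x) != 0 ->
  warped_metric rho x \in unitmx.
Proof.
move=> r0.
pose d := \row_i (if i == 0 then -1 else rho (time x) ^+ 2) : 'rV[R]_m.+1.
have -> : warped_metric rho x = diag_mx d.
  by apply/matrixP => i j; rewrite !mxE; case: eqP => // <-.
rewrite unitmxE det_diag unitfE; apply/prodf_neq0 => i _; rewrite mxE.
by case: ifP => _; rewrite ?oppr_eq0 ?oner_eq0 // expf_neq0.
Qed.

Lemma is_derive_line (V W : normedModType R) (f : V -> W) (a v : V) (l : W) :
  is_derive a v f l <-> is_derive (0 : R) (1 : R) (fun h => f (h *: v + a)) l.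
Proof.
have E (h : R) : h *: (1 : R) + 0 = h by rewrite addr0 /GRing.scale /= mulr1.
by split=> /is_derive_le H; apply/is_derive_le => e e0; have [d d0 Hd] := H e e0;
  exists d => // h hd; have := Hd h hd; rewrite /= E scale0r add0r.
Qed.

(** Only the spatial diagonal entries vary, and only with time: 4/3 t^(1/3) is the derivative of
    t^(4/3). *)
Lemma partial_eds_metric (i j k : 'I_m.+1) x : 0 < time x ->
  partial k (fun y => eds_metric y i j) x =
  if (k == 0) && (i == j) && (i != 0) then 4 / 3 * time x `^ (3^-1) else 0.
Proof.
move=> x0; rewrite /partial.
have cE (g : 'rV[R]_m.+1 -> R) (c : R) : (forall y, g y = c) -> 'D_(delta_mx 0 k) g x = 0.
  by move=> E; rewrite (_ : g = cst c) ?derive_cst //; exact/funext.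
have [->|ij] := eqVneq i j; last first.
  by rewrite andbF /= (cE _ 0) // => y; rewrite mxE (negbTE ij).
have [->|j0] := eqVneq j 0.
  by rewrite andbF (cE _ (-1)) // => y; rewrite mxE eqxx.
rewrite !andbT (_ : (fun y => _) = (fun y => (time y `^ (2 / 3)) ^+ 2)); last first.
  by apply/funext => y; rewrite mxE eqxx (negbTE j0).
have dl : is_derive (0 : R) (1 : R) (fun h => time (h *: delta_mx 0 k + x)) ((k == 0)%:R).
  have := is_derive_add (is_derive_mul (is_derive_id (0 : R) (1 : R))
    (is_derive_const ((k == 0)%:R) 0)) (is_derive_const (time x) 0).
  rewrite mulr0 mul1r !addr0; congr is_derive; apply/funext => h.
  by rewrite /time !mxE eqxx eq_sym.
have t0 : 0 < time ((0 : R) *: delta_mx 0 k + x) by rewrite scale0r add0r.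
have dp := is_derive_powR (2 / 3) t0 dl.
have dpp := (@is_derive_line _ _ (fun y => (time y `^ (2 / 3)) ^+ 2) x (delta_mx 0 k) _).2
  (@is_derive_mul _ (fun h => time (h *: delta_mx 0 k + x) `^ (2 / 3))
  (fun h => time (h *: delta_mx 0 k + x) `^ (2 / 3)) _ _ _ dp dp).
rewrite (@derive_val _ _ _ _ _ _ _ dpp) scale0r add0r.
case: ifP => _; last by rewrite !mulr0 mul0r addr0.
have -> : time x `^ (3^-1) = time x `^ (2 / 3) * time x `^ (2 / 3 - 1).
  by rewrite -powRD; [congr (_ `^ _); lra | apply/implyP => _; rewrite gt_eqF].
by rewrite mulr1; field.
Qed.

(* For the Einstein-de Sitter metric rho rho' = 2/3 t^(1/3). *)
Lemma inner_eds_christoffel x u v : 0 < time x ->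
  inner eds_metric x (\row_k \sum_i \sum_j christoffel eds_metric x k i j * u 0 i * v 0 j) u =
  2 / 3 * time x `^ (3^-1) * v 0 0 * \sum_(i < m) u 0 (lift ord0 i) ^+ 2.
Proof.
move=> x0; rewrite inner_christoffel_diag; last 2 first.
- by apply: warped_metric_unit; rewrite gt_eqF // powR_gt0.
- exact: tr_warped_metric.
rewrite big_ord_recl [X in _ + X]big1 ?addr0 => [|j _]; last first.
  rewrite big1 ?mulr0 // => i _; rewrite big1 // => l _.
  by rewrite partial_eds_metric // !mul0r.
rewrite [X in v 0 ord0 * X](_ : _ = 4 / 3 * time x `^ (3^-1) * \sum_(i < m) u 0 (lift ord0 i) ^+ 2).
  by field.
rewrite big_ord_recl big1 ?add0r => [|l _]; last first.
  by rewrite partial_eds_metric // andbF !mul0r.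
rewrite mulr_sumr; apply: eq_bigr => i _.
rewrite (bigD1 (lift ord0 i)) //= big1 ?addr0 => [|l li]; last first.
  by rewrite partial_eds_metric // andbC andbA [_ == l]eq_sym (negbTE li) !andbF !mul0r.
by rewrite partial_eds_metric // !eqxx /=; ring.
Qed.

End einstein_de_sitter_connection.

(** * Comparison with the barrier in one chart *)

Section barrier.
Context {R : realType} {m : nat}.

Lemma inner_eds (x u v : 'rV[R]_m.+1) :
  inner eds_metric x u v = - (u 0 0 * v 0 0) +
    (time x `^ (2 / 3)) ^+ 2 * \sum_i u 0 (lift ord0 i) * v 0 (lift ord0 i).
Proof. exact: inner_warped. Qed.

Lemma quadratic_form_sub (p w b : 'rV[R]_m) :
  (p *m (1%:M - b^T *m b) *m w^T) 0 0 =
  (p *m w^T) 0 0 - (p *m b^T) 0 0 * (w *m b^T) 0 0.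
Proof.
rewrite mulmxBr mulmx1 mulmxBl [LHS]mxE [X in _ + X]mxE; congr (_ - _).
rewrite (mulmxA p) -(mulmxA _ b) [LHS]mxE big_ord1; congr (_ * _).
by rewrite !dot_sum; apply: eq_bigr => i _; rewrite mulrC.
Qed.

Lemma is_derive_path (V W : normedModType R) (f : V -> W) (a v : V)
    (s : R) (l : W) :
  is_derive (s *: v + a) v f l -> is_derive (s : R) (1 : R) (fun h => f (h *: v + a)) l.
Proof.
move=> /is_derive_le H; apply/is_derive_le => e e0; have [d d0 Hd] := H e e0.
exists d => // h hd; have := Hd h hd; rewrite /= addrA -scalerDl.
by rewrite [h%:A]mulr1.
Qed.

Lemma is_derive_coord (V : normedModType R) (k : nat) (f : V -> 'rV[R]_k) (a v : V)
    (i : 'I_k) : differentiable f a ->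
  is_derive a v (fun y => f y 0 i) ('D_v f a 0 i).
Proof.
move=> df; have dfv := diff_derivable (v := v) df; split.
  exact: (derivable_mxP _ _ _).1.
by rewrite derive_mx // mxE.
Qed.

Lemma near_line (V : normedModType R) (a v : V) (P : V -> Prop) :
  (\forall z \near a, P z) -> \forall s \near (0 : R), P (s *: v + a).
Proof.
move=> Pa; have c : (fun s : R => s *: v + a) @ (0 : R) --> a.
  rewrite -[X in _ --> X](add0r a) -[X in X + a](scale0r v).
  by apply: cvgD; [apply: cvgZr_tmp; exact: cvg_id | exact: cvg_cst].
exact: c Pa.
Qed.

(* In the conformal time 3 t^(1/3) the metric is conformally flat and the level
   sets of the barrier are hyperboloids. *)
Definition barrier (r : R) (y : 'rV[R]_m) (z : 'rV[R]_m.+1) : R :=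
  3 * time z `^ (3^-1) +
  Num.sqrt (r ^+ 2 + \sum_i (z 0 (lift ord0 i) - y 0 i) ^+ 2).

(** The variation formulas are applied along the lines [s *: v + x] of a chart, for each direction
    [v]. [trace_lt0] then passes from the sign of g(Av, v) to that of the trace without choosing an
    orthonormal basis. *)
Lemma barrier_contact (U : set 'rV[R]_m) (phi n : 'rV[R]_m -> 'rV[R]_m.+1)
    (x y : 'rV[R]_m) (A : 'M[R]_m) (r : R) :
  (0 < m)%N -> open U -> U x -> smooth_on U phi -> smooth_on U n ->
  (forall z, U z -> 0 < time (phi z)) ->
  (forall z v, U z -> inner eds_metric (phi z) (n z) ('d phi z v) = 0) ->
  inner eds_metric (phi x) (n x) dt <= -1 ->
  (forall v, v != 0 -> 0 < inner eds_metric (phi x) ('d phi x v) ('d phi x v)) ->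
  (forall v, 'd phi x (v *m A) = - covariant_derivative eds_metric phi n x v) ->
  0 < r -> r^-1 < 2 / (3 * time (phi x) `^ (3^-1)) ->
  (\forall z \near x, barrier r y (phi x) <= barrier r y (phi z)) ->
  \tr A < 0.
Proof.
move=> m0 oU Ux sphi sn tpos orth ndt pos shape r0 rlt bmin.
have Unbhs : \forall z \near x, U z by exact: open_nbhs_nbhs.
have dphi z : U z -> differentiable phi z by move=> Uz; exact: (sphi [::] z).
have dphi1 v z : U z -> differentiable ('D_v phi) z.
  by move=> Uz; exact: (sphi [:: v] z).
have dn z : U z -> differentiable n z by move=> Uz; exact: (sn [::] z).
clear sphi sn.
pose X v := 'D_v phi x.
have dE z v : U z -> 'd phi z v = 'D_v phi z by move=> Uz; exact/esym/deriveE/dphi.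
pose D := Num.sqrt (r ^+ 2 + \sum_i (phi x 0 (lift ord0 i) - y 0 i) ^+ 2).
have S0 : 0 <= \sum_i (phi x 0 (lift ord0 i) - y 0 i) ^+ 2.
  by apply: sumr_ge0 => i _; rewrite sqr_ge0.
have r20 : 0 < r ^+ 2 by rewrite exprn_gt0.
have D0 : 0 < D by rewrite sqrtr_gt0; apply: ltr_pwDl.
pose b := \row_i ((phi x 0 (lift ord0 i) - y 0 i) / D) : 'rV[R]_m.
pose t0 := time (phi x).
have t00 : 0 < t0 by exact: tpos.
pose rho := t0 `^ (2 / 3).
have rho0 : 0 < rho by exact: powR_gt0.
pose J := jacobian phi x.
pose P := \matrix_(k, i) J k (lift ord0 i) : 'M[R]_m.
have XP v i : X v 0 (lift ord0 i) = (v *m P) 0 i.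
  rewrite /X deriveEjacobian; last exact: dphi.
  by rewrite !mxE; apply: eq_bigr => k _; rewrite !mxE.
have nU v : \forall s \near (0 : R), U (s *: v + x) by exact: (near_line v (P := U) Unbhs).
have H1 v : \forall s \near (0 : R), 0 < time (phi (s *: v + x)).
  by near=> s; apply: tpos; near: s; exact: nU.
have H2 v i : \forall s \near (0 : R),
    is_derive (s : R) (1 : R) (fun s => phi (s *: v + x) 0 i) ('D_v phi (s *: v + x) 0 i).
  near=> s; apply: (@is_derive_path _ _ (fun z => phi z 0 i)); apply: is_derive_coord.
  by apply: dphi; near: s; exact: nU.
have H3 v i : is_derive (0 : R) (1 : R) (fun s => 'D_v phi (s *: v + x) 0 i) ('D_v ('D_v phi) x 0 i).
  apply: (@is_derive_path _ _ (fun z => 'D_v phi z 0 i)); rewrite scale0r add0r.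
  by apply: is_derive_coord; exact: dphi1.
have H4 v i : is_derive (0 : R) (1 : R) (fun s => n (s *: v + x) 0 i) ('D_v n x 0 i).
  apply: (@is_derive_path _ _ (fun z => n z 0 i)); rewrite scale0r add0r.
  by apply: is_derive_coord; exact: dn.
have H5 v : \forall s \near (0 : R),
    - (n (s *: v + x) 0 0 * 'D_v phi (s *: v + x) 0 0) +
    (time (phi (s *: v + x)) `^ (2 / 3)) ^+ 2 *
    \sum_i n (s *: v + x) 0 (lift ord0 i) * 'D_v phi (s *: v + x) 0 (lift ord0 i) = 0.
  near=> s; have Us : U (s *: v + x) by near: s; exact: nU.
  by rewrite -inner_eds -dE //; exact: orth.
have H6 v : \forall s \near (0 : R), barrier r y (phi (0 *: v + x)) <= barrier r y (phi (s *: v + x)).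
  
  rewrite scale0r add0r.
  exact: (@near_line _ x v (fun z => barrier r y (phi x) <= barrier r y (phi z)) bmin).
have H2' v : \forall s \near (0 : R), forall i : 'I_m,
    is_derive (s : R) (1 : R) (fun s => phi (s *: v + x) 0 (lift ord0 i))
      ('D_v phi (s *: v + x) 0 (lift ord0 i)).
  by near=> s; near: s; apply: filter_forall => i; exact: H2.
have z0 v : 0 *: v + x = x by rewrite scale0r add0r.
have X0 v : X v 0 0 = - (rho * (v *m P *m b^T) 0 0).
  have := @contact_time_velocity R m (fun s => time (phi (s *: v + x)))
    (fun s => 'D_v phi (s *: v + x) 0 0) (fun i s => phi (s *: v + x) 0 (lift ord0 i))
    (fun i s => 'D_v phi (s *: v + x) 0 (lift ord0 i)) _ _ (y 0) r
    (H1 v) (H2 v 0) (H2' v) (H3 v 0) (fun i => H3 v (lift ord0 i)) r0 (H6 v).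
  rewrite !z0 -/(X v) -/D -/t0 -/rho => ->; congr (- (_ * _)).
  rewrite dot_sum mulr_suml; apply: eq_bigr => i _; rewrite -XP mxE; ring.
(* A vector killed by [P] has a purely temporal image, whose square is not positive; spacelikeness
   excludes it unless it is 0. *)
have uP : P \in unitmx.
  rewrite -row_free_unit; apply: inj_row_free => v vP0; apply/eqP; apply: contraT => v0.
  have := pos v v0; rewrite !dE // -/(X v) inner_eds big1.
    by rewrite mulr0 addr0 oppr_gt0 -expr2 ltNge sqr_ge0.
  by move=> i _; rewrite XP vP0 mxE mul0r.
(* The first variation replaces the time components, so the induced metric takes the form required
   by [trace_lt0], up to the factor [rho ^+ 2]. *)
have innXY u v : inner eds_metric (phi x) (X u) (X v) =
    rho ^+ 2 * (u *m P *m (1%:M - b^T *m b) *m P^T *m v^T) 0 0.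
  rewrite inner_eds -/t0 -/rho X0 X0 -[_ *m P^T *m v^T]mulmxA -trmx_mul.
  rewrite quadratic_form_sub.
  rewrite (_ : \sum_i _ = (u *m P *m (v *m P)^T) 0 0); first by ring.
  by rewrite dot_sum; apply: eq_bigr => i _; rewrite !XP.
have n0_ge1 : 1 <= n x 0 0.
  move: ndt; rewrite inner_eds big1 => [|i _]; last by rewrite !mxE mulr0.
  by rewrite mulr0 addr0 lerN2 !mxE eqxx mulr1.
have n0_gt0 : 0 < n x 0 0 by exact: lt_le_trans n0_ge1.
have nuE i : n x 0 (lift ord0 i) * (rho * D) =
    - (n x 0 0 * (phi x 0 (lift ord0 i) - y 0 i)).
  (* The tangent vector whose spatial part is the i-th basis vector; orthogonality of the normal to
     it yields the i-th component. *)
  pose v := (delta_mx 0 i : 'rV[R]_m) *m invmx P.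
  have vP : v *m P = delta_mx 0 i by rewrite /v mulmxKV.
  have := orth x v Ux; rewrite dE // -/(X v) inner_eds -/t0 -/rho X0 vP.
  rewrite dot_sum (bigD1 i) //= big1 => [|j ji]; last by rewrite mxE (negbTE ji) andbF mul0r.
  rewrite [X in _ ^+ 2 * X](bigD1 i) //= big1 => [|j ji]; last first.
    by rewrite XP vP mxE (negbTE ji) andbF mulr0.
  rewrite XP vP !mxE !eqxx !mul1r !mulr1 !addr0 => /eqP.
  rewrite mulrN opprK expr2 -mulrA mulrCA -mulrDr mulf_eq0 gt_eqF //= => /eqP e.
  have -> : phi x 0 (lift ord0 i) - y 0 i = (phi x 0 (lift ord0 i) - y 0 i) / D * D.
    by rewrite divfK // gt_eqF.
  move: (_ / D) e => bi e; apply/eqP; rewrite -addr_eq0; apply/eqP.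
  rewrite -[RHS](mulr0 D) -e; ring.
have b1 : (b *m b^T) 0 0 < 1.
  rewrite dot_sum (_ : \sum_i _ = (\sum_i (phi x 0 (lift ord0 i) - y 0 i) ^+ 2) / D ^+ 2); last first.
    rewrite mulr_suml; apply: eq_bigr => i _; rewrite !mxE; field.
    by rewrite gt_eqF.
  rewrite ltr_pdivrMr ?exprn_gt0 // mul1r sqr_sqrtr ?ltrDr //.
  by rewrite addr_ge0 // ltW.
apply: (trace_lt0 m0 uP b1) => v v0.
have gX := pos v v0; rewrite dE // -/(X v) innXY pmulr_rgt0 ?exprn_gt0 // in gX.
suff lt0 : inner eds_metric (phi x) (X (v *m A)) (X v) < 0.
  by move: lt0; rewrite innXY pmulr_rlt0 // exprn_gt0.
have -> : X (v *m A) = - covariant_derivative eds_metric phi n x v.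
  by rewrite -shape dE.
rewrite innerNl innerDl inner_eds_christoffel // inner_eds -/t0 -/rho.
have := @contact_second_order R m (fun s => time (phi (s *: v + x)))
  (fun s => 'D_v phi (s *: v + x) 0 0) (fun s => n (s *: v + x) 0 0)
  (fun i s => phi (s *: v + x) 0 (lift ord0 i))
  (fun i s => 'D_v phi (s *: v + x) 0 (lift ord0 i))
  (fun i s => n (s *: v + x) 0 (lift ord0 i)) _ _ _ _ (y 0) r
  (H1 v) (H2 v 0) (H2' v) (H3 v 0) (fun i => H3 v (lift ord0 i))
  (H4 v 0) (fun i => H4 v (lift ord0 i)) (H5 v) r0 (H6 v).
rewrite !z0 -/(X v) -/D -/t0 -/rho => /(_ nuE n0_gt0).
(* The factor |v_s|^2 - <b, v_s>^2 of the second variation is the induced square of [v] divided by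
   [rho ^+ 2], hence positive. *)
have KE : \sum_i X v 0 (lift ord0 i) ^+ 2 -
    ((\sum_i (phi x 0 (lift ord0 i) - y 0 i) * X v 0 (lift ord0 i)) / D) ^+ 2 =
    (v *m P *m (1%:M - b^T *m b) *m P^T *m v^T) 0 0.
  rewrite -[_ *m P^T *m v^T]mulmxA -trmx_mul quadratic_form_sub; congr (_ - _).
    by rewrite dot_sum; apply: eq_bigr => i _; rewrite XP expr2.
  rewrite expr2 dot_sum mulr_suml; congr (_ * _); apply: eq_bigr => i _; rewrite XP [b _ _]mxE; ring.
rewrite KE; move: (\sum_i _ * _) (\sum_i _ ^+ 2) => s1 s2 le.
(* Here [D >= r], and the subtracted term is rho' at the contact point. *)
have lt : D^-1 - 2 / (3 * t0 `^ (3^-1)) < 0.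
  rewrite subr_lt0; apply: le_lt_trans rlt; rewrite lef_pV2 ?posrE //.
  rewrite -[leLHS](ger0_norm (ltW r0)) -sqrtr_sqr ler_wsqrtr //.
  by rewrite lerDl.
have := mulr_gt0 (mulr_gt0 rho0 n0_gt0) gX; rewrite -(nmulr_rlt0 _ lt).
rewrite mulrC => /(le_lt_trans le); lra.
Unshelve. all: by end_near. Qed.

End barrier.

(** * Local inversion *)

Section row_norms.
Context {R : realType}.

Lemma coord_le_norm n (u : 'rV[R]_n) i : `|u 0 i| <= `|u|.
Proof.
rewrite [leRHS]/Num.Def.normr /= mx_normrE.
exact: (le_bigmax _ (fun i : 'I_1 * 'I_n => `|u i.1 i.2|) (0, i)).
Qed.

Lemma norm_le_coord n (u : 'rV[R]_n) (C : R) : 0 <= C ->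
  (forall i, `|u 0 i| <= C) -> `|u| <= C.
Proof.
move=> C0 uC; rewrite [leLHS]/Num.Def.normr /= mx_normrE.
by apply: bigmax_le => // -[i j] _ /=; rewrite ord1.
Qed.

Lemma norm_mulmx_le n k (B : 'M[R]_(n, k)) :
  exists2 C : R, 0 < C & forall u : 'rV[R]_n, `|u *m B| <= C * `|u|.
Proof.
pose C := 1 + \sum_i \sum_j `|B i j|.
have C1 : 1 <= C by rewrite lerDl; apply: sumr_ge0 => i _; exact: sumr_ge0.
exists C => [|u]; first exact: lt_le_trans C1.
apply: norm_le_coord => [|j]; first by rewrite mulr_ge0 // ltW // (lt_le_trans _ C1).
rewrite mxE; apply: le_trans (ler_norm_sum _ _ _) _.
apply: (@le_trans _ _ (\sum_i `|u| * `|B i j|)).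
  by apply: ler_sum => i _; rewrite normrM ler_wpM2r // coord_le_norm.
rewrite -mulr_sumr mulrC ler_wpM2r //.
apply: (@le_trans _ _ (\sum_i \sum_j `|B i j|)); last by rewrite lerDr.
by apply: ler_sum => i _; rewrite (bigD1 j) //= lerDl sumr_ge0.
Qed.

Lemma nbhs_distP (V : normedModType R) (x : V) (P : set V) :
  nbhs x P <-> exists2 d : R, 0 < d & forall y, `|y - x| < d -> P y.
Proof.
split=> [/nbhs_ballP [d /= d0 H]|[d d0 H]].
  by exists d => // y yx; apply: H; rewrite -ball_normE /= distrC.
by apply/nbhs_ballP; exists d => //= y; rewrite -ball_normE /= distrC; exact: H.
Qed.

Lemma continuous_atP (V W : normedModType R) (g : V -> W) (x : V) :
  {for x, continuous g} <-> forall e : R, 0 < e -> exists2 d : R, 0 < d &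
    forall y, `|y - x| < d -> `|g y - g x| < e.
Proof.
split=> [/cvgrPdist_lt H e e0|H].
  have /nbhs_distP[d d0 Hd] := H e e0; exists d => // y yx.
  by rewrite distrC; exact: Hd.
apply/cvgrPdist_lt => e e0; have [d d0 Hd] := H e e0.
apply/nbhs_distP; exists d => // y yx.
by rewrite distrC; exact: Hd.
Qed.

Lemma continuous_dist (V : normedModType R) (x : V) : continuous (fun z => `|z - x|).
Proof.
move=> z; apply/(@continuous_atP V R) => e e0; exists e => // y yz.
by apply: le_lt_trans (ler_dist_dist _ _) _; rewrite opprB addrA subrK.
Qed.

Lemma open_dist_lt (V : normedModType R) (x : V) (d : R) :
  open [set z | `|z - x| < d].
Proof.
rewrite (_ : [set z | _] = (fun z => `|z - x|) @^-1` [set t | t < d]) //.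
by apply: open_comp; [move=> z _; exact: continuous_dist | exact: open_lt].
Qed.

Lemma compact_closed_dist n (x : 'rV[R]_n) (d : R) :
  compact [set z | `|z - x| <= d].
Proof.
apply: bounded_closed_compact.
  exists (`|x| + d); split; first exact: num_real.
  move=> M xM z /= zd; apply: (le_trans _ (ltW xM)).
  by rewrite -[z](subrK x) addrC (le_trans (ler_normD _ _)) // lerD2l.
rewrite (_ : [set z | _] = (fun z : 'rV[R]_n => `|z - x|) @^-1` [set t | t <= d]) //.
apply: closed_comp; last exact: closed_le.
by move=> z _; exact: continuous_dist.
Qed.

End row_norms.

Section local_inverse.
Context {R : realType}.

(** Continuity is asked for one direction at a time; in finite dimension [diff_continuous_norm]
    makes it uniform over directions. *)
Definition C1_on (V W : normedModType R) (U : set V) (f : V -> W) : Prop :=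
  forall x, U x -> differentiable f x /\ forall v, {for x, continuous ('D_v f)}.

Lemma diff_continuous_norm m k (U : set 'rV[R]_m) (f : 'rV[R]_m -> 'rV[R]_k) x (e : R) :
  open U -> C1_on U f -> U x -> 0 < e -> exists2 d : R, 0 < d &
    forall y, `|y - x| < d -> U y /\ forall v, `|'d f y v - 'd f x v| <= e * `|v|.
Proof.
move=> oU Cf Ux e0.
have [d1 d10 H1] : exists2 d : R, 0 < d & forall y, `|y - x| < d -> U y.
  by apply/nbhs_distP; exact: open_nbhs_nbhs.
(* The tolerance is shared among the [m] basis directions; the denominator [m.+1] is nonzero even
   for [m = 0]. *)
have [d2 d20 H2] : exists2 d : R, 0 < d & forall y, `|y - x| < d ->
    forall i : 'I_m, `|'D_(delta_mx 0 i) f y - 'D_(delta_mx 0 i) f x| < e / m.+1%:R.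
  apply/nbhs_distP; near=> y; move=> i; move: i; near: y; apply: filter_forall => i.
  apply/nbhs_distP; have /continuous_atP := (Cf x Ux).2 (delta_mx 0 i).
  by apply; rewrite divr_gt0.
exists (Num.min d1 d2) => [|y]; first by rewrite lt_min d10.
rewrite lt_min => /andP[yd1 yd2]; have Uy := H1 y yd1; split; first exact: Uy.
move=> v.
have E z : U z -> 'd f z v = \sum_i v 0 i *: 'D_(delta_mx 0 i) f z.
  move=> Uz; rewrite [X in 'd f z X]row_sum_delta linear_sum; apply: eq_bigr => i _.
  rewrite linearZ; congr (_ *: _); exact/esym/deriveE/(Cf z Uz).1.
have -> : 'd f y v - 'd f x v = \sum_i v 0 i *: 'D_(delta_mx 0 i) f y -
    \sum_i v 0 i *: 'D_(delta_mx 0 i) f x by congr (_ - _); exact: E.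
rewrite -sumrB; apply: le_trans (ler_norm_sum _ _ _) _.
apply: (@le_trans _ _ (\sum_(i < m) `|v| * (e / m.+1%:R))).
  apply: ler_sum => i _; rewrite -scalerBr normrZ.
  by apply: ler_pM => //; [exact: coord_le_norm | exact/ltW/H2].
rewrite sumr_const card_ord -[leLHS]mulr_natr -[leLHS]mulrA [leRHS]mulrC ler_wpM2l //.
by rewrite mulrAC ler_pdivrMr // ler_wpM2l ?ltW // ltr_nat.
Unshelve. all: by end_near. Qed.

(** The mean value theorem on the segment from [z] to [y], one coordinate at a time. The norm of
    rows is the maximum norm, so coordinatewise bounds combine without loss. *)
Lemma strict_differentiability m k (U : set 'rV[R]_m) (f : 'rV[R]_m -> 'rV[R]_k) x (e : R) :
  open U -> C1_on U f -> U x -> 0 < e -> exists2 d : R, 0 < d &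
    forall y z, `|y - x| < d -> `|z - x| < d ->
      `|f y - f z - 'd f x (y - z)| <= e * `|y - z|.
Proof.
move=> oU Cf Ux e0; have [d d0 H] := diff_continuous_norm oU Cf Ux e0.
(* naming the differential keeps unification from unfolding it *)
have [T TE] : exists T : 'rV[R]_m -> 'rV[R]_m -> 'rV[R]_k, (fun y v => 'd f y v) = T.
  by exists (fun y v => 'd f y v).
have dT y v : U y -> 'D_v f y = T y v by move=> /Cf[df _]; rewrite -TE; exact: deriveE.
have {}H y : `|y - x| < d -> U y /\ forall v, `|T y v - T x v| <= e * `|v|.
  by move=> /H; rewrite -TE.
exists d; first exact: d0.
move=> y z yd zd; rewrite -[ 'd f x (y - z)]/((fun y v => 'd f y v) x (y - z)) TE; clear TE.
apply: norm_le_coord => [|i]; first by rewrite mulr_ge0 // ltW.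
pose v := y - z; pose p (s : R) := s *: v + z.
have pd (s : R) : 0 <= s <= 1 -> `|p s - x| < d.
  move=> /andP[s0 s1]; have -> : p s - x = s *: (y - x) + (1 - s) *: (z - x).
    by rewrite /p /v; apply/rowP => j; rewrite !mxE; ring.
  apply: le_lt_trans (ler_normD _ _) _; rewrite !normrZ (ger0_norm s0) ger0_norm ?subr_ge0 //.
  have [->|s10] := eqVneq s 0; first by rewrite mul0r add0r subr0 mul1r.
  have : 0 < s by rewrite lt_def s10.
  nra.
have pU (s : R) : 0 <= s <= 1 -> U (p s) by move=> /pd/H[].
have bd (s : R) : 0 <= s <= 1 -> `|'D_v f (p s) 0 i - T x v 0 i| <= e * `|v|.
  move=> s01; have [Up /(_ v)] := H _ (pd s s01); rewrite dT //.
  by apply: le_trans; have := coord_le_norm (T (p s) v - T x v) i; rewrite !mxE.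
move: (T x v) bd => w bd.
pose h (s : R) := f (p s) 0 i - s * w 0 i.
have dh (s : R) : U (p s) -> is_derive (s : R) (1 : R) h ('D_v f (p s) 0 i - w 0 i).
  move=> Up.
  have df := @is_derive_path _ _ _ (fun y => f y 0 i) z v s _
    (@is_derive_coord _ _ _ _ _ v i (Cf _ Up).1).
  have := is_derive_add df (is_derive_opp (is_derive_mul (is_derive_id (s : R) (1 : R))
    (is_derive_const (w 0 i) s))).
  by rewrite mulr0 mul1r addr0.
have [|||c c01] := @MVT_segment R h (fun s => 'D_v f (p s) 0 i - w 0 i) 0 1.
- exact: ler01.
- by move=> s; rewrite in_itv /= => /andP[s0 s1]; apply/dh/pU; rewrite !ltW.
- apply: derivable_within_continuous => s; rewrite in_itv /= => s01.
  by apply: ex_derive; exact/dh/pU.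
rewrite in_itv /= in c01; rewrite subr0 mulr1 => hE.
have -> : (f y - f z - w) 0 i = h 1 - h 0.
  by rewrite /h /p scale1r scale0r add0r /v subrK !mxE; ring.
by rewrite hE; exact: bd.
Qed.

(** Near [x] the map differs from its differential by at most half of the expansion of the
    differential, which gives the lower bound. Surjectivity comes from minimizing |f z - w| over a
    compact ball: at a nonzero minimum, a small step along the preimage of [w - f z] under the
    differential at [x] would lower it. *)
Lemma local_inverse m (U : set 'rV[R]_m) (f : 'rV[R]_m -> 'rV[R]_m) x :
  open U -> C1_on U f -> U x -> injective ('d f x) ->
  exists d k : R, exists g : 'rV[R]_m -> 'rV[R]_m,
  [/\ 0 < d, 0 < k,
    (forall y, `|y - x| < d -> U y),
    (forall y z, `|y - x| < d -> `|z - x| < d -> k * `|y - z| <= `|f y - f z|) &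
    (forall w, `|w - f x| < k -> `|g w - x| < d /\ f (g w) = w)].
Proof.
move=> oU Cf Ux inj.
have dfx := (Cf x Ux).1.
pose J := jacobian f x.
have JE v : 'd f x v = v *m J by rewrite -deriveE // deriveEjacobian.
have uJ : J \in unitmx.
  rewrite -row_free_unit; apply: inj_row_free => v vJ.
  by apply: inj; rewrite JE vJ linear0.
have [C C0 HC] := norm_mulmx_le (invmx J).
(* The differential expands by at least [2 * k]; the error of strict differentiability is taken to
   be [k], and [k] remains for [f]. *)
pose k := (2 * C)^-1.
have k0 : 0 < k by rewrite invr_gt0 mulr_gt0.
have Jlow (v : 'rV[R]_m) : 2 * k * `|v| <= `|v *m J|.
  have := HC (v *m J); rewrite mulmxK // => h.
  by rewrite /k invfM mulVKf // ler_pdivrMl.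
have [d1 d10 H1] : exists2 d : R, 0 < d & forall y, `|y - x| < d -> U y.
  by apply/nbhs_distP; exact: open_nbhs_nbhs.
have [d2 d20 H2] := strict_differentiability oU Cf Ux k0.
pose d := Num.min d1 d2 / 2.
have d0 : 0 < d by rewrite divr_gt0 // lt_min d10.
have dd y : `|y - x| <= d -> `|y - x| < d1 /\ `|y - x| < d2.
  have m0 : 0 < Num.min d1 d2 by rewrite lt_min d10.
  move=> yd; apply/andP; rewrite -lt_min; apply: le_lt_trans yd _.
  by rewrite ltr_pdivrMr // ltr_pMr // ltr1n.
have low y z : `|y - x| <= d -> `|z - x| <= d -> k * `|y - z| <= `|f y - f z|.
  move=> /dd[_ yd] /dd[_ zd].
  have := H2 y z yd zd; rewrite JE => h.
  have := Jlow (y - z).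
  have : `|(y - z) *m J| <= `|f y - f z| + `|f y - f z - (y - z) *m J|.
    by rewrite -{1}[_ *m J](subKr (f y - f z)) ler_normB.
  lra.
(* The radius [k * d / 2] forces the minimizer off the boundary: its image is closer than [k * d] to
   [f x], so [low] puts it closer than [d] to [x]. *)
have sur w : `|w - f x| < k * d / 2 -> exists y, `|y - x| < d /\ f y = w.
  move=> wx; pose B := [set z : 'rV[R]_m | `|z - x| <= d].
  have cB : {within B, continuous (fun z => `|f z - w|)}.
    apply: continuous_in_subspaceT => z; rewrite inE /= => zd.
    apply: (@continuous_comp _ _ _ f (fun u => `|u - w|)); last exact: continuous_dist.
    by apply: differentiable_continuous; apply: (Cf z _).1; apply: H1; case: (dd z zd).
  have [|z] := EVT_min_rV _ (@compact_closed_dist R m x d) cB.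
    by exists x; rewrite /= subrr normr0 ltW.
  rewrite inE /= => zd zmin.
  have fxx : `|f z - w| <= `|f x - w|.
    by apply: zmin; rewrite inE /= subrr normr0 ltW.
  have fx' : `|f z - w| < k * d / 2 by apply: le_lt_trans fxx _; rewrite distrC.
  have zd' : `|z - x| < d.
    have xx : `|x - x| <= d by rewrite subrr normr0 ltW.
    have h1 := low z x zd xx.
    have h2 : `|f z - f x| <= `|f z - w| + `|w - f x| by rewrite -[f z - f x](subrKA w) ler_normD.
    rewrite -(ltr_pM2l k0); lra.
  exists z; split=> //; apply: contrapT => fzw.
  have fw0 : 0 < `|f z - w| by rewrite normr_gt0 subr_eq0; apply/eqP.
  pose v := (w - f z) *m invmx J.
  have vJ : v *m J = w - f z by rewrite mulmxKV.
  have vle : k * `|v| <= `|f z - w| / 2.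
    by have := Jlow v; rewrite vJ [`|w - _|]distrC; lra.
  (* a small step along v lowers the distance to w *)
  pose s := Num.min 1 ((d - `|z - x|) / (1 + `|v|)).
  have v1 : 0 < 1 + `|v| by rewrite ltr_pwDl.
  have s0 : 0 < s by rewrite lt_min ltr01 divr_gt0 // subr_gt0.
  have s1 : s <= 1 by rewrite ge_min lexx.
  have sv : s * (1 + `|v|) <= d - `|z - x| by rewrite -ler_pdivlMr // ge_min lexx orbT.
  have zsd : `|s *: v + z - x| <= d.
    rewrite -addrA; apply: le_trans (ler_normD _ _) _; rewrite normrZ gtr0_norm //.
    lra.
  have := zmin (s *: v + z); rewrite inE /= => /(_ zsd).
  have := H2 (s *: v + z) z (dd _ zsd).2 (dd _ zd).2.
  rewrite addrK JE -scalemxAl vJ normrZ gtr0_norm // => h2.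
  have -> : f (s *: v + z) - w = (f (s *: v + z) - f z - s *: (w - f z)) + (1 - s) *: (f z - w).
    by apply/rowP => j; rewrite !mxE; ring.
  apply/negP; rewrite -ltNge; apply: le_lt_trans (ler_normD _ _) _.
  rewrite normrZ ger0_norm ?subr_ge0 //.
  nra.
pose g w := if pselect (exists y, `|y - x| < d /\ f y = w) is left P then projT1 (cid P) else x.
(* One constant serves both as expansion factor and as radius of the image ball. *)
exists d, (Num.min k (k * d / 2)), g; split=> //.
- by rewrite lt_min k0 divr_gt0 // mulr_gt0.
- by move=> y /ltW /dd [/H1].
- move=> y z /ltW yd /ltW zd; apply: le_trans (low y z yd zd).
  by rewrite ler_wpM2r // ge_min lexx.
- move=> w; rewrite lt_min => /andP[_ wd]; rewrite /g; case: pselect => [P|/(_ (sur w wd))//].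
  exact: (projT2 (cid P)).
Qed.

End local_inverse.

(** * Sections of local diffeomorphisms and lifts of curves *)

Lemma continuous_in_charts (R : realType) (m : nat) (M : smooth_manifold R m)
    (V : normedModType R) (F : M -> V) :
  (forall c x, atlas c -> chart_cod c x -> differentiable (F \o chart_inv c) x) ->
  continuous F.
Proof.
move=> dF p; have [c ac cp] := atlas_cover p.
have fc : {for c p, continuous (F \o chart_inv c)}.
  exact/differentiable_continuous/(dF c _ ac (chart_map_cod cp)).
have ccp : {for p, continuous c} by exact: chart_map_cts.
have Fp : (F \o chart_inv c) (c p) = F p by rewrite /= chart_mapK.
have : (F \o chart_inv c) (c q) @[q --> p] --> F p.
  by rewrite -Fp; exact: (continuous_comp ccp fc).
apply: cvg_trans; apply: near_eq_cvg; near=> q; rewrite /= chart_mapK //.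
by near: q; exact: (open_nbhs_nbhs (conj (@chart_dom_open _ _ _ c) cp)).
Unshelve. all: by end_near. Qed.

Section sections_of_local_diffeomorphisms.
Context {R : realType} {m : nat} {M : smooth_manifold R m}.
Variable F : M -> 'rV[R]_m.
Hypothesis F_C1 : forall c, atlas c -> C1_on (chart_cod c) (F \o chart_inv c).
Hypothesis F_inj : forall c x, atlas c -> chart_cod c x ->
  injective ('d (F \o chart_inv c) x).

Lemma local_diffeo_continuous : continuous F.
Proof. by apply: continuous_in_charts => c x ac cx; exact: (F_C1 ac cx).1. Qed.

Definition section_on (W : set 'rV[R]_m) (s : 'rV[R]_m -> M) : Prop :=
  forall w, W w -> F (s w) = w /\ {for w, continuous s}.

(** A local inverse read in a chart. The last clause, that the section is also a left inverse near
    [q], is what yields uniqueness of lifts. *)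
Lemma local_section (q : M) : exists (e : R) (s : 'rV[R]_m -> M),
  [/\ 0 < e, section_on [set w | `|w - F q| < e] s &
      \forall p \near q, s (F p) = p].
Proof.
have [c ac cq] := atlas_cover q; set x := c q.
have Ux : chart_cod c x by exact: chart_map_cod.
have [d [k [g [d0 k0 dU low sur]]]] :=
  local_inverse (@chart_cod_open _ _ _ c) (F_C1 ac) Ux (@F_inj c x ac Ux).
have fx : (F \o chart_inv c) x = F q by rewrite /= chart_mapK.
rewrite fx in sur.
exists k, (chart_inv c \o g); split=> //.
  move=> w /= wk; have [gw fgw] := sur w wk; split; first exact: fgw.
  apply: (@continuous_comp _ _ _ g (chart_inv c)); last by apply: chart_inv_cts; exact: dU.
  apply/(@continuous_atP R) => e e0.
  (* The first bound gives continuity through [low]; the second keeps [w'] in the ball where [g]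
     inverts the map. *)
  exists (Num.min (k * e) (k - `|w - F q|)) => [|w'].
    by rewrite lt_min mulr_gt0 //= subr_gt0.
  rewrite lt_min ltrBrDr => /andP[w'e w'k].
  have [gw' fgw'] : `|g w' - x| < d /\ (F \o chart_inv c) (g w') = w'.
    by apply: sur; rewrite -[w' - F q](subrKA w) (le_lt_trans (ler_normD _ _)).
  rewrite -(ltr_pM2l k0); apply: le_lt_trans (low _ _ gw' gw) _.
  by rewrite fgw' fgw.
near=> p.
have cp : chart_dom c p.
  by near: p; exact: (open_nbhs_nbhs (conj (@chart_dom_open _ _ _ c) cq)).
have cpd : `|c p - x| < d.
  near: p; have /cvgrPdist_lt/(_ d d0) : {for q, continuous c} by exact: chart_map_cts.
  by apply: filterS => p; rewrite distrC.
have Fpk : `|F p - F q| < k.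
  near: p; have /cvgrPdist_lt/(_ k k0) := @local_diffeo_continuous q.
  by apply: filterS => p; rewrite distrC.
have [gd fg] := sur _ Fpk.
have := low _ _ gd cpd; rewrite fg /= chart_mapK // subrr normr0.
rewrite pmulr_rle0 // normr_le0 subr_eq0 => /eqP ->.
by rewrite chart_mapK.
Unshelve. all: by end_near. Qed.

(** The set where the lifts agree is open, since F has local left inverses, and closed, since M is
    Hausdorff; the unit interval is connected. *)
Lemma lift_unique (u v : R -> M) : continuous u -> continuous v ->
  (forall s, F (u s) = F (v s)) -> u 0 = v 0 -> u 1 = v 1.
Proof.
move=> cu cv Fuv uv0; pose C := [set s | u s = v s].
have oC : open C.
  rewrite openE => s /= us.
  have [e [t [_ _ tF]]] := local_section (u s).
  have tFv : \forall p \near v s, t (F p) = p by rewrite -us.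
  have nu : \forall s' \near s, t (F (u s')) = u s' by exact: (cu s _ tF).
  have nv : \forall s' \near s, t (F (v s')) = v s' by exact: (cv s _ tFv).
  by rewrite /interior /=; near=> s'; rewrite /C /= -(near nu s') // -(near nv s') // Fuv.
have cC : closed C.
  rewrite -openC openE => s /= us.
  have := @manifold_hausdorff R m M; rewrite open_hausdorff => /(_ (u s) (v s)).
  have neq : u s != v s by apply/eqP.
  move=> /(_ neq) [[A B] /= [uA vB] [oA oB AB]].
  rewrite /interior /=; near=> s' => uv.
  have A' : A (u s').
    by near: s'; apply: cu; apply: open_nbhs_nbhs; split => //; exact/set_mem.
  have B' : B (v s').
    by near: s'; apply: cv; apply: open_nbhs_nbhs; split => //; exact/set_mem.
  have : (A `&` B) (u s') by split; rewrite // uv.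
  by rewrite (eqP AB).
have E : `[0, 1]%classic `&` C = `[0, 1]%classic.
  apply: segment_connected; [|by exists C|by exists C].
  by exists 0; split=> //=; rewrite in_itv /= lexx ler01.
have : (`[0, 1]%classic : set R) 1 by rewrite /= in_itv /= ler01 lexx.
by rewrite -E => -[].
Unshelve. all: by end_near. Qed.

(** Convexity. Being stable under intersection, it keeps the overlap of two balls connected, so that
    sections agreeing at one point of it agree on all of it. *)
Definition segment_closed (W : set 'rV[R]_m) : Prop :=
  forall a b (s : R), W a -> W b -> 0 <= s <= 1 -> W (s *: (b - a) + a).

Lemma segment_closed_ball x (e : R) : segment_closed [set w | `|w - x| < e].
Proof.
move=> a b s /= ax bx /andP[s0 s1].
have -> : s *: (b - a) + a - x = s *: (b - x) + (1 - s) *: (a - x).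
  by apply/rowP => j; rewrite !mxE; ring.
apply: le_lt_trans (ler_normD _ _) _; rewrite !normrZ (ger0_norm s0) ger0_norm ?subr_ge0 //.
have [->|s10] := eqVneq s 0; first by rewrite mul0r add0r subr0 mul1r.
have : 0 < s by rewrite lt_def s10.
nra.
Qed.

Lemma segment_closedI W1 W2 :
  segment_closed W1 -> segment_closed W2 -> segment_closed (W1 `&` W2).
Proof. by move=> h1 h2 a b s [? ?] [? ?] s01; split; [exact: h1 | exact: h2]. Qed.

Lemma section_unique W s1 s2 a b : segment_closed W ->
  section_on W s1 -> section_on W s2 -> W a -> W b -> s1 a = s2 a -> s1 b = s2 b.
Proof.
move=> cW S1 S2 Wa Wb sa.
(* Clamping the parameter to the unit interval makes the segment a curve on the whole line, as
   [lift_unique] requires. *)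
pose cl (s : R) : R := Num.max 0 (Num.min 1 s).
have cl01 s : 0 <= cl s <= 1.
  by rewrite le_max lexx /= ge_max ler01 ge_min lexx.
pose p (s : R) := cl s *: (b - a) + a.
have cp : continuous p.
  move=> s; apply: cvgD; last exact: cvg_cst.
  apply: cvgZr_tmp; apply: continuous_max; first exact: cvg_cst.
  by apply: continuous_min; [exact: cvg_cst | exact: cvg_id].
have Wp s : W (p s) by exact: cW.
have csp s0 : section_on W s0 -> continuous (s0 \o p).
  by move=> S0 s; apply: continuous_comp; [exact: cp | exact: (S0 _ (Wp s)).2].
have p0 : p 0 = a.
  by rewrite /p /cl min_r ?ler01 // maxxx scale0r add0r.
have p1 : p 1 = b.
  by rewrite /p /cl minxx max_r ?ler01 // scale1r subrK.
have := lift_unique (csp _ S1) (csp _ S2) _ _; rewrite /= p0 p1; apply => //.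
by move=> s; rewrite (S1 _ (Wp s)).1 (S2 _ (Wp s)).1.
Qed.

Lemma section_onS W1 W2 s : W1 `<=` W2 -> section_on W2 s -> section_on W1 s.
Proof. by move=> W12 S w /W12/S. Qed.

(** By uniqueness the section coincides with the local section at [p], which is a left inverse of F
    there. Hence the image of the section contains a neighbourhood of [p]. *)
Lemma section_local_inverse W s p : open W -> section_on W s -> W (F p) ->
  s (F p) = p -> \forall p' \near p, s (F p') = p'.
Proof.
move=> oW S WF sF.
have [d d0 Wd] : exists2 d : R, 0 < d & forall y, `|y - F p| < d -> W y.
  by apply/nbhs_distP; exact: open_nbhs_nbhs.
have [e [t [e0 St tF]]] := local_section p.
pose r := Num.min d e; have r0 : 0 < r by rewrite lt_min d0.
have sb (W' : set 'rV[R]_m) : (forall y, `|y - F p| < d -> `|y - F p| < e -> W' y) ->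
    [set w | `|w - F p| < r] `<=` W'.
  by move=> h y /=; rewrite lt_min => /andP[]; exact: h.
have Sr := section_onS (sb _ (fun y h _ => Wd y h)) S.
have Tr := section_onS (sb _ (fun y _ h => h)) St.
have near_r : \forall p' \near p, `|F p' - F p| < r.
  have /cvgrPdist_lt/(_ r r0) := @local_diffeo_continuous p.
  by apply: filterS => p'; rewrite distrC.
near=> p'.
have tp' : t (F p') = p' by near: p'.
rewrite -[RHS]tp'; apply: (section_unique (@segment_closed_ball (F p) r) Sr Tr (a := F p)).
- by rewrite /= subrr normr0.
- by rewrite /=; near: p'.
- by rewrite sF (nbhs_singleton tF).
Unshelve. all: by end_near. Qed.

End sections_of_local_diffeomorphisms.

(** * Regularity of lifted curves *)

Section lifts_of_curves.
Context {R : realType} {m : nat}.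

Lemma injective_diff_lower (f : 'rV[R]_m -> 'rV[R]_m) x :
  differentiable f x -> injective ('d f x) ->
  (exists2 k : R, 0 < k & forall v, k * `|v| <= `|'d f x v|) /\
  forall z, exists w, 'd f x w = z.
Proof.
move=> dfx inj; pose J := jacobian f x.
have JE v : 'd f x v = v *m J by rewrite -deriveE // deriveEjacobian.
have uJ : J \in unitmx.
  rewrite -row_free_unit; apply: inj_row_free => v vJ.
  by apply: inj; rewrite JE vJ linear0.
have [C C0 HC] := norm_mulmx_le (invmx J).
split=> [|z]; last by exists (z *m invmx J); rewrite JE mulmxKV.
exists C^-1; first by rewrite invr_gt0.
by move=> v; rewrite JE ler_pdivrMl //; have := HC (v *m J); rewrite mulmxK.
Qed.

Variables (U : set 'rV[R]_m) (f : 'rV[R]_m -> 'rV[R]_m).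
Hypothesis oU : open U.
Hypothesis f_C1 : C1_on U f.
Hypothesis f_inj : forall x, U x -> injective ('d f x).
Implicit Types (y z : R -> 'rV[R]_m) (t : R).

(** Strict differentiability of [f] turns increments of [z] into increments of [y] up to a small
    multiple of the latter, and the lower bound of the differential absorbs that multiple. *)
Lemma lift_is_derive y z t (z' : 'rV[R]_m) : U (y t) -> {for t, continuous y} ->
  (\forall s \near t, f (y s) = z s) -> is_derive (t : R) (1 : R) z z' ->
  exists2 w, 'd f (y t) w = z' & is_derive (t : R) (1 : R) y w.
Proof.
move=> Uy cy fy dz; set x := y t.
have [[k k0 klow] sur] := injective_diff_lower (f_C1 Uy).1 (f_inj Uy).
have [w wE] := sur z'; exists w => //.
have SD e := @strict_differentiability R m m U f x e oU f_C1 Uy.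
rewrite -/x in klow wE.
have [L LE] : exists L : {linear 'rV[R]_m -> 'rV[R]_m}, L = 'd f x by exists ('d f x).
rewrite -LE in klow wE SD; clear LE sur.
have ft : f x = z t by exact: nbhs_singleton fy.
apply/is_derive_le => e e0.
pose B := 1 + `|z'|.
have B0 : 0 < B by rewrite ltr_pwDl.
(* The bound [k / 2] absorbs the error and gives [k * |Dy| <= 2 * B * |h|]; inserting this, the
   second bound makes the error at most half of [e * |h|]. The other half is left to [e2]. *)
pose e1 := Num.min (k / 2) (k * k * e / (4 * B)).
have e10 : 0 < e1 by rewrite lt_min !divr_gt0 ?mulr_gt0.
have [d d0 Hd] := SD e1 e10.
pose e2 := Num.min 1 (k * e / 2).
have e20 : 0 < e2 by rewrite lt_min ltr01 divr_gt0 ?mulr_gt0.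
have [d1 d10 Hz] := (is_derive_le z t 1 z').1 dz e2 e20.
have [d2 d20 Hy] := (continuous_atP y t).1 cy d d0.
have [d3 d30 Hf] := (nbhs_distP _ _).1 fy.
exists (Num.min d1 (Num.min d2 d3)) => [|h]; first by rewrite !lt_min d10 d20.
rewrite !lt_min => /and3P[h1 h2 h3].
have ht : `|h *: (1 : R) + t - t| = `|h| by rewrite addrK [h%:A]mulr1.
set t' := h *: 1 + t in ht *.
have zz := Hz h h1; rewrite -/t' in zz.
have fy' : f (y t') = z t' by apply: Hf; rewrite ht.
have yd : `|y t' - x| < d by apply: Hy; rewrite ht.
have xd : `|x - x| < d by rewrite subrr normr0.
have := Hd _ _ yd xd; rewrite fy' ft -/x.
set Dy := y t' - x; set Dz := z t' - z t in zz * => HL.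
have Le1 : e1 <= k / 2 by rewrite ge_min lexx.
have Le1' : e1 * (4 * B) <= k * k * e.
  by rewrite -ler_pdivlMr ?mulr_gt0 // ge_min lexx orbT.
have Le2 : e2 <= 1 by rewrite ge_min lexx.
have Le2' : e2 <= k * e / 2 by rewrite ge_min lexx orbT.
have DzB : `|Dz| <= B * `|h|.
  have : `|Dz| <= `|Dz - h *: z'| + `|h *: z'| by rewrite -{1}[Dz](subrK (h *: z')) ler_normD.
  by rewrite normrZ /B; have := normr_ge0 h; nra.
have DyB : k * `|Dy| <= 2 * B * `|h|.
  have : `|L Dy| <= `|Dz| + `|Dz - L Dy|.
    by rewrite -{1}[L Dy](subKr Dz) ler_normB.
  by have := klow Dy; have := normr_ge0 Dy; nra.
have H : k * `|Dy - h *: w| <= e1 * `|Dy| + e2 * `|h|.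
  apply: le_trans (klow _) _; rewrite linearB linearZ wE.
  have -> : L Dy - h *: z' = - (Dz - L Dy) + (Dz - h *: z').
    by rewrite opprB addrA subrK.
  by apply: le_trans (ler_normD _ _) _; rewrite normrN lerD.
have hh := normr_ge0 h.
rewrite -(ler_pM2l k0); apply: le_trans H _.
have -> : k * (e * `|h|) = k * e / 2 * `|h| + k * e / 2 * `|h| by field.
apply: lerD; last by rewrite ler_wpM2r.
rewrite -(ler_pM2l k0).
have : e1 * (k * `|Dy|) <= e1 * (2 * B * `|h|) by rewrite ler_wpM2l // ltW.
nra.
Qed.

Lemma lift_derive1_continuous y z t : U (y t) ->
  (\forall s \near t, {for s, continuous y}) ->
  (\forall s \near t, f (y s) = z s) ->
  (\forall s \near t, derivable z s 1) -> {for t, continuous (z^`())%classic} ->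
  {for t, continuous (y^`())%classic}.
Proof.
move=> Uy cy fy dz cz.
have cyt := nbhs_singleton cy.
have nU : \forall s \near t, U (y s).
  by apply: cyt; exact: open_nbhs_nbhs.
have [T TE] : exists T : 'rV[R]_m -> {linear 'rV[R]_m -> 'rV[R]_m},
  (fun v => ('d f v : {linear 'rV[R]_m -> 'rV[R]_m})) = T by exists (fun v => 'd f v).
have Ty : \forall s \near t, T (y s) (y^`()%classic s) = z^`()%classic s.
  near=> s.
  have Us : U (y s) by near: s.
  have cs : {for s, continuous y} by near: s.
  have fs : \forall s' \near s, f (y s') = z s' by near: s; exact: (nbhs_interior fy).
  have dzs : derivable z s 1 by near: s.
  have [w wE dw] := lift_is_derive Us cs fs (derivableP dzs).
  by rewrite -TE !derive1E (@derive_val _ _ _ _ _ _ _ dw).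
have Tyt := nbhs_singleton Ty.
have [[k k0 klow] _] := injective_diff_lower (f_C1 Uy).1 (f_inj Uy).
have Tnear e : 0 < e -> exists2 d : R, 0 < d &
    forall x, `|x - y t| < d -> forall v, `|T x v - T (y t) v| <= e * `|v|.
  move=> e0; have [d d0 Hd] := diff_continuous_norm oU f_C1 Uy e0.
  by exists d => // x /Hd[_]; rewrite -TE.
have {}klow v : k * `|v| <= `|T (y t) v| by rewrite -TE; exact: klow.
clear TE; apply/continuous_atP => e e0.
set w := y^`()%classic t.
have b0 : 0 < 1 + `|w| by rewrite ltr_pwDl.
(* With [|v| <= |v - w| + |w|], the bound [k / 2] absorbs the term in [|v - w|]; the rest is at most
   [k * e / 8 + k * e / 4], less than [k * e / 2]. *)
pose e1 := Num.min (k / 2) (k * e / (4 * (1 + `|w|))).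
have e10 : 0 < e1 by rewrite lt_min !divr_gt0 ?mulr_gt0.
have [d d0 Hd] := Tnear e1 e10.
have [d2 d20 Hy] := (continuous_atP y t).1 cyt d d0.
have ke0 : 0 < k * e / 8 by rewrite divr_gt0 ?mulr_gt0.
have [d3 d30 Hz] := (continuous_atP _ t).1 cz _ ke0.
have [d4 d40 HT] := (nbhs_distP _ _).1 Ty.
exists (Num.min d2 (Num.min d3 d4)) => [|s]; first by rewrite !lt_min d20 d30.
rewrite !lt_min => /and3P[h2 h3 h4].
have Ts := HT _ h4; have zs := Hz _ h3; have dT := Hd _ (Hy _ h2) (y^`()%classic s).
set v := y^`()%classic s in Ts dT *.
have Le1 : e1 <= k / 2 by rewrite ge_min lexx.
have Le1' : e1 * (4 * (1 + `|w|)) <= k * e.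
  by rewrite -ler_pdivlMr ?mulr_gt0 // ge_min lexx orbT.
have sub3 (a b c' : 'rV[R]_m) : a - b = (c' - b) - (c' - a).
  by apply/rowP => j; rewrite !mxE; ring.
have H : k * `|v - w| <= k * e / 8 + e1 * `|v|.
  apply: le_trans (klow _) _; rewrite linearB -/w Tyt.
  have -> : T (y t) v - z^`()%classic t = (z^`()%classic s - z^`()%classic t) - (T (y s) v - T (y t) v).
    by rewrite Ts; exact: sub3.
  by apply: le_trans (ler_normB _ _) _; rewrite lerD // ltW.
have vw : `|v| <= `|v - w| + `|w| by rewrite -{1}[v](subrK w) ler_normD.
have h1 := ler_wpM2l (ltW e10) vw.
have h5 := ler_wpM2r (normr_ge0 (v - w)) Le1.
rewrite -(ltr_pM2l k0); move: H h1 h5 Le1' e10 ke0.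
move: (`|v - w|) (`|v|) (`|w|) => D V W H h1 h5 h6 e10 ke0.
clear - H h1 h5 h6 e10 ke0; lra.
Unshelve. all: by end_near. Qed.

End lifts_of_curves.

Section C1_lifts.
Context {R : realType} {m : nat} {M : smooth_manifold R m}.
Variable F : M -> 'rV[R]_m.
Hypothesis F_C1 : forall c, atlas c -> C1_on (chart_cod c) (F \o chart_inv c).
Hypothesis F_inj : forall c x, atlas c -> chart_cod c x ->
  injective ('d (F \o chart_inv c) x).

(** The induced distance is an infimum over [C1_curve], so a lifted segment bounds it only once the
    lift is known to be C^1 in every chart. *)
Lemma C1_curve_lift (gamma : R -> M) (z : R -> 'rV[R]_m) :
  continuous gamma -> (forall s, F (gamma s) = z s) ->
  (forall s, derivable z s 1) -> continuous (z^`())%classic -> C1_curve gamma.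
Proof.
move=> cg Fz dz cz; split; first exact: cg.
move=> c t ac ct.
have Ut : chart_cod c ((c \o gamma) t) by exact: chart_map_cod.
have nd : \forall s \near t, chart_dom c (gamma s).
  by apply: cg; apply: open_nbhs_nbhs; split => //; exact: chart_dom_open.
have cs : \forall s \near t, {for s, continuous (c \o gamma)}.
  near=> s; apply: continuous_comp; first exact: cg.
  by apply: chart_map_cts; near: s.
have fs : \forall s \near t, (F \o chart_inv c) ((c \o gamma) s) = z s.
  by near=> s; rewrite /= chart_mapK //; near: s.
have [w _ dw] := lift_is_derive (@chart_cod_open _ _ _ c) (F_C1 ac)
  (fun x => @F_inj c x ac) Ut (nbhs_singleton cs) fs (derivableP (dz t)).
split; first exact: ex_derive.
apply: (lift_derive1_continuous (@chart_cod_open _ _ _ c) (F_C1 ac)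
  (fun x => @F_inj c x ac) Ut cs fs); last exact: cz.
by near=> s; exact: dz.
Unshelve. all: by end_near. Qed.

End C1_lifts.

(** * The distance of the induced metric *)

Section lengths.
Context {R : realType} {m : nat} {M : smooth_manifold R m}.
Variable psi : M -> 'rV[R]_m.+1.
Hypothesis psi_hyp : eds_spacelike_hypersurface psi.

(** The integral of a nonnegative function is a supremum over the simple functions below it, so it
    is monotone in integrand and domain without any measurability of the speed of a curve. *)
Lemma le_integral_patch (f g : R -> \bar R) (D E : set R) :
  (forall x, E x -> 0 <= g x)%E -> (forall x, D x -> 0 <= f x)%E ->
  (forall x, D x -> E x /\ (f x <= g x)%E) ->
  (\int[lebesgue_measure]_(x in D) f x <= \int[lebesgue_measure]_(x in E) g x)%E.
Proof.
move=> g0 f0 fg; rewrite !ge0_integralE //; apply: ereal_sup_le => _ [h hf <-].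
exists h => //= x; apply: (le_trans (hf x)); rewrite /patch.
case: ifPn => [/set_mem /fg [Ex fgx]|_]; first by rewrite mem_set.
by case: ifPn => // /set_mem /g0.
Qed.

Lemma curve_length_le (G : 'rV[R]_m.+1 -> 'M[R]_m.+1) (gamma : R -> M) (C : R) :
  (forall t, 0 <= t <= 1 -> Num.sqrt (inner G (psi (gamma t))
     ((psi \o gamma)^`()%classic t) ((psi \o gamma)^`()%classic t)) <= C) ->
  (curve_length G psi gamma <= C%:E)%E.
Proof.
move=> H; have C0 : 0 <= C.
  by apply: (le_trans (sqrtr_ge0 _) (H 0 _)); rewrite lexx ler01.
rewrite /curve_length -[leRHS]mule1.
have <- : lebesgue_measure (`[0%R, 1%R]%classic : set R) = 1%E :> \bar R.
  by rewrite lebesgue_measure_itv /= lte_fin ltr01 sube0.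
rewrite -integral_cst //; apply: le_integral_patch => //=.
- move=> x; rewrite in_itv /= => x01; split=> //.
  by rewrite lee_fin; exact: H.
Qed.

Lemma chart_smooth c : atlas c -> smooth_on (chart_cod c) (psi \o chart_inv c).
Proof. by case: psi_hyp => _ [+ _] _; apply. Qed.

Lemma chart_differentiable c x : atlas c -> chart_cod c x ->
  differentiable (psi \o chart_inv c) x.
Proof. by move=> ac cx; exact: (chart_smooth ac [::] cx). Qed.

Lemma is_derive_along_curve (c : chart R m M) (gamma : R -> M) t :
  atlas c -> continuous gamma -> chart_dom c (gamma t) ->
  derivable (c \o gamma) t 1 ->
  is_derive (t : R) (1 : R) (psi \o gamma)
    ('d (psi \o chart_inv c) (c (gamma t)) ((c \o gamma)^`()%classic t)).
Proof.
move=> ac cg ct dcg.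
have d1 : differentiable (c \o gamma) t by exact/derivable1_diffP.
have d2 : differentiable (psi \o chart_inv c) ((c \o gamma) t).
  by apply: chart_differentiable ac _; exact: chart_map_cod.
have : is_derive (t : R) (1 : R) ((psi \o chart_inv c) \o (c \o gamma))
    ('d (psi \o chart_inv c) (c (gamma t)) ((c \o gamma)^`()%classic t)).
  split; first exact/derivable1_diffP/differentiable_comp.
  rewrite deriveE; last exact: differentiable_comp.
  rewrite diff_comp //= derive1E deriveE //.
apply: near_eq_is_derive.
have nd : \forall s \near t, chart_dom c (gamma s).
  by apply: cg; apply: open_nbhs_nbhs; split => //; exact: chart_dom_open.
by near=> s; rewrite /= chart_mapK //; near: s.
Unshelve. all: by end_near. Qed.

Definition space (p : M) : 'rV[R]_m := col' ord0 (psi p).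

Let col0_continuous : continuous (col' ord0 : 'rV[R]_m.+1 -> 'rV[R]_m).
Proof.
move=> x; apply/(@continuous_atP R) => e e0; exists e => // y yx.
apply: le_lt_trans yx; apply: norm_le_coord => // i.
by have := coord_le_norm (y - x) (lift ord0 i); rewrite !mxE.
Qed.

Lemma space_C1 c : atlas c -> C1_on (chart_cod c) (space \o chart_inv c).
Proof.
move=> ac x cx.
have dpsi y : chart_cod c y -> differentiable (psi \o chart_inv c) y.
  exact: chart_differentiable.
have lin y : differentiable (col' ord0 : 'rV[R]_m.+1 -> 'rV[R]_m) y.
  exact: linear_differentiable.
have dsp y : chart_cod c y -> differentiable (space \o chart_inv c) y.
  move=> cy; have := differentiable_comp (dpsi _ cy) (lin _); exact.
have E v y : chart_cod c y ->
    'D_v (space \o chart_inv c) y = col' ord0 ('D_v (psi \o chart_inv c) y).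
  move=> cy; rewrite deriveE; last exact: dsp.
  rewrite (_ : space \o chart_inv c = (col' ord0 : 'rV[R]_m.+1 -> 'rV[R]_m) \o (psi \o chart_inv c)) //.
  rewrite diff_comp //=; last exact: dpsi.
  by rewrite (diff_lin _ col0_continuous) -deriveE //; exact: dpsi.
split; first exact: dsp.
move=> v.
have cD : {for x, continuous ('D_v (psi \o chart_inv c))}.
  apply: differentiable_continuous; exact: (chart_smooth ac [:: v] cx).
have : (col' ord0 ('D_v (psi \o chart_inv c) y) : 'rV[R]_m) @[y --> x] -->
    'D_v (space \o chart_inv c) x.
  by rewrite E //; exact: (continuous_comp cD (@col0_continuous _)).
have nE : \forall y \near x, (col' ord0 ('D_v (psi \o chart_inv c) y) : 'rV[R]_m) =
    'D_v (space \o chart_inv c) y.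
  apply: filterS (open_nbhs_nbhs (conj (@chart_cod_open _ _ _ c) cx)) => y cy.
  by rewrite E.
by move=> h; exact: (cvg_trans (near_eq_cvg nE) h).
Qed.

Lemma diff_space c x v : atlas c -> chart_cod c x ->
  'd (space \o chart_inv c) x v = col' ord0 ('d (psi \o chart_inv c) x v).
Proof.
move=> ac cx.
rewrite (_ : space \o chart_inv c = (col' ord0 : 'rV[R]_m.+1 -> 'rV[R]_m) \o (psi \o chart_inv c)) //.
rewrite diff_comp /=; first by rewrite (diff_lin _ col0_continuous).
  exact: chart_differentiable.
exact: linear_differentiable.
Qed.

(** Two vectors with the same spatial image differ by one with a purely temporal image, which a
    Riemannian induced metric allows only for 0. *)
Lemma space_inj c x : atlas c -> chart_cod c x ->
  injective ('d (space \o chart_inv c) x).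
Proof.
move=> ac cx u v; rewrite !diff_space // => uv.
apply/eqP; rewrite -subr_eq0; apply: contraT => uv0.
have [_ _ /(_ c x (u - v) ac cx uv0)] := psi_hyp.
rewrite /induced_metric inner_eds big1 => [|i _].
  by rewrite mulr0 addr0 oppr_gt0 -expr2 ltNge sqr_ge0.
have /rowP/(_ i) : col' ord0 ('d (psi \o chart_inv c) x (u - v)) = 0 :> 'rV[R]_m.
  rewrite linearB; apply/rowP => j; move/rowP/(_ j): uv.
  by rewrite !mxE => ->; rewrite subrr.
by rewrite !mxE => ->; rewrite mul0r.
Qed.

End lengths.

Section distance_along_sections.
Context {R : realType} {m : nat} {M : smooth_manifold R m}.
Variable psi : M -> 'rV[R]_m.+1.
Hypothesis psi_hyp : eds_spacelike_hypersurface psi.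
Variable T : R.
Hypothesis time_le : forall p, time (psi p) <= T.

(* sin^2 has vanishing velocity at 0 and pi/2, so the lift of a segment is C^1
   on the whole line and stays over the segment. *)
Let theta (t : R) : R := sin (t * (pi / 2)) ^+ 2.
Let theta' (t : R) : R := pi * sin (t * (pi / 2)) * cos (t * (pi / 2)).

Let dtheta t : is_derive (t : R) (1 : R) theta (theta' t).
Proof.
have dl : is_derive (t : R) (1 : R) (fun s => s * (pi / 2)) (pi / 2).
  have := is_derive_mul (is_derive_id (t : R) (1 : R)) (is_derive_const (pi / 2) t).
  by rewrite mulr0 mul1r addr0.
have ds := @is_derive1_comp _ sin (fun s => s * (pi / 2)) t _ _ (is_derive_sin _) dl.
have := is_derive_mul ds ds.
by apply: is_derive_eq1; rewrite /theta' /=; field.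
Qed.

Let theta01 t : 0 <= theta t <= 1.
Proof. by rewrite /theta sqr_ge0 sin2cos2 gerBl sqr_ge0. Qed.

Let theta'_le t : `|theta' t| <= pi.
Proof.
rewrite /theta' !normrM (ger0_norm (pi_ge0 R)) -mulrA ler_piMr ?pi_ge0 //.
by rewrite mulr_ile1 // ler_norml ?sin_geN1 ?sin_le1 ?cos_geN1 ?cos_le1.
Qed.

Lemma is_derive_scale (V : normedModType R) (h : R -> R) (a : R) (t : R) (v w : V) :
  is_derive (t : R) (1 : R) h a ->
  is_derive (t : R) (1 : R) (fun s => h s *: v + w) (a *: v).
Proof.
move=> /is_derive_le H; apply/is_derive_le => e e0.
have v0 : 0 < 1 + `|v| by rewrite ltr_pwDl.
have [|d d0 Hd] := H (e / (1 + `|v|)); first by rewrite divr_gt0.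
exists d => // k kd; have := Hd k kd.
set h1 := h (k *: 1 + t) => hd.
have -> : h1 *: v + w - (h t *: v + w) - k *: (a *: v) = (h1 - h t - k *: a) *: v.
  by rewrite opprD addrACA subrr addr0 scalerA -!scalerBl.
rewrite normrZ; apply: le_trans (ler_wpM2r (normr_ge0 v) hd) _.
rewrite mulrAC ler_wpM2r // mulrAC ler_pdivrMr // ler_wpM2l ?ltW //.
by rewrite ltrDr.
Qed.

(** The segment from [a] to [b] is lifted by the section, and g <= rho^2 |dF|^2 bounds the length of
    the lift. The constant depends neither on the section nor on its domain, which makes
    continuation to larger balls possible. *)
Lemma dist_section_le : exists2 C : R, 0 < C &
  forall (W : set 'rV[R]_m) (s : 'rV[R]_m -> M) a b,
    segment_closed W -> section_on (space psi) W s -> W a -> W b ->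
    (induced_dist eds_metric psi (s a) (s b) <= (C * `|b - a|)%:E)%E.
Proof.
have tpos p : 0 < time (psi p) by case: psi_hyp => + _ _; apply.
have T0 : 0 <= T by have [p _] := manifold_nonempty M; exact: ltW (lt_le_trans (tpos p) (time_le p)).
(* The factors bound rho, the passage from the maximum norm to the Euclidean norm, and |theta'|; the
   summand 1 makes the constant positive. *)
exists (T `^ (2 / 3) * m.+1%:R * pi + 1) => [|W s a b cW S Wa Wb].
  by rewrite ltr_wpDl ?ltr01 // mulr_ge0 ?pi_ge0 // mulr_ge0 ?powR_ge0 ?ler0n.
pose z (t : R) : 'rV[R]_m := theta t *: (b - a) + a.
have dz t : is_derive (t : R) (1 : R) z (theta' t *: (b - a)) by exact: is_derive_scale.
have Wz t : W (z t) by exact: cW.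
have cz : continuous z.
  by move=> t; apply/differentiable_continuous/derivable1_diffP/ex_derive.
pose gamma := s \o z.
have cg : continuous gamma.
  by move=> t; apply: continuous_comp; [exact: cz | exact: (S _ (Wz t)).2].
have Fg t : space psi (gamma t) = z t by exact: (S _ (Wz t)).1.
have zE : (z^`())%classic = fun t => theta' t *: (b - a).
  by apply/funext => t; rewrite derive1E (@derive_val _ _ _ _ _ _ _ (dz t)).
have C1g : C1_curve gamma.
  apply: (C1_curve_lift (@space_C1 _ _ _ _ psi_hyp) (@space_inj _ _ _ _ psi_hyp) cg Fg).
    by move=> t; exact: ex_derive.
  rewrite zE => t.
  have dl : is_derive (t : R) (1 : R) (fun s => s * (pi / 2)) (1 * (pi / 2) + t * 0).
    exact: (is_derive_mul (is_derive_id (t : R) (1 : R)) (is_derive_const (pi / 2) t)).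
  have ds := @is_derive1_comp _ sin (fun s => s * (pi / 2)) t _ _ (is_derive_sin _) dl.
  have dc := @is_derive1_comp _ cos (fun s => s * (pi / 2)) t _ _ (is_derive_cos _) dl.
  have dsc := is_derive_mul (is_derive_mul (is_derive_const pi t) ds) dc.
  have := is_derive_scale (b - a) 0 dsc.
  rewrite (_ : (fun s => _) = (fun t => theta' t *: (b - a))); last first.
    by apply/funext => r; rewrite addr0.
  by move=> h; apply/differentiable_continuous/derivable1_diffP/ex_derive.
have z0 : z 0 = a by rewrite /z /theta mul0r sin0 expr0n scale0r add0r.
have z1 : z 1 = b by rewrite /z /theta mul1r sin_pihalf expr1n scale1r subrK.
apply: ge_ereal_inf; exists (curve_length eds_metric psi gamma).
  exists gamma; last by [].
  by split; [exact: C1g | rewrite /gamma /= z0 | rewrite /gamma /= z1].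
apply: curve_length_le => // t _.
have [c ac ct] := atlas_cover (gamma t).
have dp := is_derive_along_curve psi_hyp ac cg ct (C1g.2 c t ac ct).1.
set D := ((psi \o gamma)^`())%classic t.
have DE i : D 0 (lift ord0 i) = theta' t * (b - a) 0 i.
  rewrite /D derive1E derive_mx; last exact: ex_derive.
  rewrite mxE (_ : (fun s => _) = fun s => z s 0 i); last first.
    by apply/funext => s'; rewrite -Fg /space mxE.
  have := derive_mx (ex_derive (is_derive := dz t)).
  by rewrite (@derive_val _ _ _ _ _ _ _ (dz t)) => /rowP/(_ i); rewrite !mxE => <-.
set K := T `^ (2 / 3) * m.+1%:R * pi.
have K0 : 0 <= K by rewrite mulr_ge0 ?pi_ge0 // mulr_ge0 ?powR_ge0 ?ler0n.
apply: (@le_trans _ _ (K * `|b - a|)); last by rewrite mulrDl lerDl mulr_ge0.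
have Kb0 : 0 <= K * `|b - a| by rewrite mulr_ge0.
have -> : K * `|b - a| = Num.sqrt ((K * `|b - a|) ^+ 2) by rewrite sqrtr_sqr ger0_norm.
apply: ler_wsqrtr; rewrite inner_eds.
apply: (@le_trans _ _ ((T `^ (2 / 3)) ^+ 2 * (m.+1%:R ^+ 2 * (pi * `|b - a|) ^+ 2))); last first.
  by rewrite le_eqVlt; apply/orP; left; apply/eqP; rewrite /K; ring.
(* The contribution of -dt^2 is not positive and is dropped. *)
rewrite -[leRHS]add0r; apply: lerD; first by rewrite oppr_le0 -expr2 sqr_ge0.
apply: ler_pM; rewrite ?exprn_ge0 ?powR_ge0 ?sumr_ge0 //.
- by move=> i _; rewrite -expr2 sqr_ge0.
- apply: lerXn2r; rewrite ?nnegrE ?powR_ge0 //; apply: ge0_ler_powR => //.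
  + by rewrite nnegrE ltW.
apply: (@le_trans _ _ (\sum_(i < m) (pi * `|b - a|) ^+ 2)).
  apply: ler_sum => i _; rewrite DE -expr2 -real_normK ?num_real // normrM.
  apply: lerXn2r; rewrite ?nnegrE ?mulr_ge0 ?pi_ge0 //.
  by apply: ler_pM => //; exact: coord_le_norm.
rewrite sumr_const card_ord -[leLHS]mulr_natl ler_wpM2r ?sqr_ge0 //.
by rewrite -natrX ler_nat; apply: (leq_trans (leqnSn m)); rewrite -[X in (X <= _)%N]expn1 leq_pexp2l.
Qed.

End distance_along_sections.

(** * Lower bounds for the induced metric and its lengths *)

Section metric_near_a_point.
Context {R : realType} {m : nat}.

Lemma cvg_sumr (T : Type) (G : set_system T) (n : nat) (f : 'I_n -> T -> R) (l : 'I_n -> R) :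
  Filter G -> (forall i, f i x @[x --> G] --> l i) ->
  \sum_i f i x @[x --> G] --> \sum_i l i.
Proof.
by move=> FG fl; apply: cvg_big => //; exact: add_continuous.
Qed.

Lemma quadratic_form_min (B : 'I_m -> 'I_m -> R) :
  (forall v : 'rV[R]_m, v != 0 -> 0 < \sum_i \sum_j v 0 i * v 0 j * B i j) ->
  exists2 k : R, 0 < k & forall v : 'rV[R]_m,
    k * `|v| ^+ 2 <= \sum_i \sum_j v 0 i * v 0 j * B i j.
Proof.
move=> pos; pose Q (v : 'rV[R]_m) := \sum_i \sum_j v 0 i * v 0 j * B i j.
(* Without unit vectors every vector is 0 and any constant works; otherwise the minimum over the
   compact unit sphere is the constant. *)
have [[v0 v01]|no] := pselect (exists v : 'rV[R]_m, `|v| = 1); last first.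
  exists 1 => // v; have [->|v0] := eqVneq v 0.
    rewrite normr0 expr0n mulr0; apply: sumr_ge0 => i _; apply: sumr_ge0 => j _.
    by rewrite mxE !mul0r.
  exfalso; apply: no; exists (`|v|^-1 *: v).
  by rewrite normrZ normfV normr_id mulVf // normr_eq0.
have cQ : continuous Q.
  move=> v; apply: (@cvg_sumr _ (nbhs v)) => i; apply: (@cvg_sumr _ (nbhs v)) => j.
  have c k : {for v, continuous (fun v : 'rV[R]_m => v 0 k)} by exact: coord_continuous.
  exact: (continuousM (continuousM (c i) (c j)) (@cst_continuous _ _ (B i j) v)).
have cS : compact [set v : 'rV[R]_m | `|v| = 1].
  apply: bounded_closed_compact.
    by exists 1; split=> // M M1 v /= ->; exact: ltW.
  rewrite (_ : [set v | _] = (fun v : 'rV[R]_m => `|v|) @^-1` [set 1]); last by [].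
  apply: closed_comp; last exact: closed_eq.
  by move=> v _; exact: norm_continuous.
have [||w] := @EVT_min_rV R m Q _ _ cS.
- by exists v0.
- exact: continuous_subspaceT.
rewrite inE /= => w1 wmin.
exists (Q w) => [|v].
  by apply: pos; rewrite -normr_eq0 w1 oner_eq0.
have [->|v0'] := eqVneq v 0.
  rewrite normr0 expr0n mulr0; apply: sumr_ge0 => i _; apply: sumr_ge0 => j _.
  by rewrite mxE !mul0r.
have vn : 0 < `|v| by rewrite normr_gt0.
have := wmin (`|v|^-1 *: v); rewrite inE /= normrZ normfV normr_id mulVf ?gt_eqF // => /(_ erefl).
have -> : Q (`|v|^-1 *: v) = Q v / `|v| ^+ 2.
  rewrite /Q mulr_suml; apply: eq_bigr => i _; rewrite mulr_suml; apply: eq_bigr => j _.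
  by rewrite !mxE; field; rewrite gt_eqF.
by rewrite ler_pdivlMr // exprn_gt0.
Qed.

(** Near [x] the coefficients move so little that at most half of the minimal value at [x] is lost;
    the square root puts the remaining half in the form of a bound on speed. *)
Lemma quadratic_form_near (T : topologicalType) (B : T -> 'I_m -> 'I_m -> R) (x : T) :
  (forall i j, {for x, continuous (fun z => B z i j)}) ->
  (forall v : 'rV[R]_m, v != 0 -> 0 < \sum_i \sum_j v 0 i * v 0 j * B x i j) ->
  exists2 k : R, 0 < k & \forall z \near x, forall v : 'rV[R]_m,
    (k * `|v|) ^+ 2 <= \sum_i \sum_j v 0 i * v 0 j * B z i j.
Proof.
move=> cB pos; have [k k0 kmin] := quadratic_form_min pos.
pose e := k / 2 / (m.+1 * m.+1)%:R.
have e0 : 0 < e by rewrite !divr_gt0.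
exists (Num.sqrt (k / 2)) => [|]; first by rewrite sqrtr_gt0 divr_gt0.
have near_e : \forall z \near x, forall ij : 'I_m * 'I_m, `|B x ij.1 ij.2 - B z ij.1 ij.2| < e.
  near=> z => ij; move: ij; near: z; apply: filter_forall => -[i j] /=.
  by have /cvgrPdist_lt/(_ e e0) := cB i j.
near=> z => v.
have ne : forall ij : 'I_m * 'I_m, `|B x ij.1 ij.2 - B z ij.1 ij.2| < e by near: z.
have {}ne i j : `|B x i j - B z i j| <= e by exact/ltW/(ne (i, j)).
rewrite exprMn sqr_sqrtr; last by rewrite divr_ge0 // ltW.
have dv : \sum_i \sum_j v 0 i * v 0 j * B x i j - \sum_i \sum_j v 0 i * v 0 j * B z i j <=
    k / 2 * `|v| ^+ 2.
  rewrite -sumrB.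
  apply: (@le_trans _ _ (\sum_(i < m) \sum_(j < m) `|v| ^+ 2 * e)).
    apply: ler_sum => i _; rewrite -sumrB; apply: ler_sum => j _.
    rewrite -mulrBr; apply: le_trans (ler_norm _) _; rewrite normrM.
    apply: ler_pM => //; rewrite normrM expr2.
    by apply: ler_pM => //; exact: coord_le_norm.
  rewrite sumr_const card_ord sumr_const card_ord -mulrnA -[leLHS]mulr_natr -mulrA.
  rewrite mulrC ler_wpM2r ?sqr_ge0 // /e mulrAC ler_pdivrMr ?ltr0n ?muln_gt0 //.
  by rewrite ler_wpM2l ?divr_ge0 ?(ltW k0) // ler_nat leq_mul.
by have := kmin v; lra.
Unshelve. all: by end_near. Qed.

End metric_near_a_point.

Section induced_metric_bound.
Context {R : realType} {m : nat} {M : smooth_manifold R m}.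
Variable psi : M -> 'rV[R]_m.+1.
Hypothesis psi_hyp : eds_spacelike_hypersurface psi.

Lemma induced_metric_near (c : chart R m M) x : atlas c -> chart_cod c x ->
  exists2 k : R, 0 < k & \forall z \near x, forall v : 'rV[R]_m,
    (k * `|v|) ^+ 2 <= induced_metric eds_metric psi c z v v.
Proof.
move=> ac cx; pose phi := psi \o chart_inv c.
pose B z i j := inner eds_metric (phi z) ('D_(delta_mx 0 i) phi z) ('D_(delta_mx 0 j) phi z).
have BE z v : chart_cod c z ->
    induced_metric eds_metric psi c z v v = \sum_i \sum_j v 0 i * v 0 j * B z i j.
  move=> cz; have dz := chart_differentiable psi_hyp ac cz.
  rewrite /induced_metric -/phi -(deriveE v dz) /B /inner; move: (eds_metric (phi z)) => Gz.
  pose J := jacobian phi z; pose Q := J *m Gz *m J^T.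
  have DE u : 'D_u phi z = u *m J by rewrite deriveEjacobian.
  have QE (u w : 'rV[R]_m) : u *m J *m Gz *m (w *m J)^T = u *m Q *m w^T.
    by rewrite trmx_mul /Q !mulmxA.
  rewrite DE QE.
  have := @inner_sum R m (fun=> Q) 0 v v; rewrite /inner => ->.
  apply: eq_bigr => i _; apply: eq_bigr => j _.
  rewrite mulrAC; congr (_ * _); rewrite !DE QE.
  by rewrite -rowE trmx_delta -colE !mxE.
have cD k l : {for x, continuous (fun z => 'D_(delta_mx 0 k) phi z 0 l)}.
  have c1 : {for x, continuous ('D_(delta_mx 0 k) phi)}.
    exact/differentiable_continuous/(chart_smooth psi_hyp ac [:: _] cx).
  exact: (continuous_comp c1 (@coord_continuous _ _ _ 0 l _)).
have ct : {for x, continuous (fun z => time (phi z) `^ (2 / 3))}.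
  have cp : {for x, continuous phi}.
    exact/differentiable_continuous/(chart_smooth psi_hyp ac [::] cx).
  have c1 := continuous_comp cp (@coord_continuous _ _ _ 0 0 (phi x)).
  have t0 : 0 < time (phi x) by case: psi_hyp => + _ _; apply.
  have d1 : is_derive (time (phi x) : R) (1 : R) (fun t => t `^ (2 / 3)) _ := is_derive1_powR (2 / 3) t0.
  have c2 : {for time (phi x), continuous (fun t => t `^ (2 / 3))}.
    exact/differentiable_continuous/derivable1_diffP/(ex_derive (is_derive := d1)).
  exact: (continuous_comp c1 c2).
have cB i j : {for x, continuous (fun z => B z i j)}.
  rewrite (_ : (fun z => B z i j) = fun z =>
    - ('D_(delta_mx 0 i) phi z 0 0 * 'D_(delta_mx 0 j) phi z 0 0) +
    (time (phi z) `^ (2 / 3)) ^+ 2 * \sum_k 'D_(delta_mx 0 i) phi z 0 (lift ord0 k) *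
    'D_(delta_mx 0 j) phi z 0 (lift ord0 k)); last by apply/funext => z; rewrite /B inner_eds.
  have h3 : {for x, continuous (fun z => \sum_k 'D_(delta_mx 0 i) phi z 0 (lift ord0 k) *
      'D_(delta_mx 0 j) phi z 0 (lift ord0 k))}.
    apply: (@cvg_sumr _ _ (nbhs x)) => k.
    exact: (continuousM (cD i (lift ord0 k)) (cD j (lift ord0 k))).
  exact: (continuousD (continuousN (continuousM (cD i 0) (cD j 0)))
    (continuousM (continuousM ct ct) h3)).
have [|k k0 kB] := @quadratic_form_near R m _ B x cB.
  move=> v v0; rewrite -BE //.
  by case: psi_hyp => _ _; apply.
exists k => //; near=> z => v; rewrite BE; last first.
  by near: z; exact: (open_nbhs_nbhs (conj (@chart_cod_open _ _ _ c) cx)).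
by move: v; near: z.
Unshelve. all: by end_near. Qed.

End induced_metric_bound.

Section small_distance.
Context {R : realType} {m : nat} {M : smooth_manifold R m}.
Variable psi : M -> 'rV[R]_m.+1.
Hypothesis psi_hyp : eds_spacelike_hypersurface psi.

Lemma norm_eq_coord n (u : 'rV[R]_n) : u != 0 -> exists i, `|u| = `|u 0 i|.
Proof.
move=> u0; have [|[i j] h] := @mx_norm_neq0 R 1 n u.
  by apply: contra_neq u0; exact: mx_norm_eq0.
by exists j; rewrite [LHS]h ord1.
Qed.

(** The maximum norm of the displacement is attained at one coordinate. The fundamental theorem of
    calculus for that coordinate bounds the displacement by the integral of the coordinate speed,
    hence by the length. Only the part of the curve on [a, 1] has to lie in the chart. *)
Lemma curve_length_ge (c : chart R m M) (gamma : R -> M) (a k : R) :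
  atlas c -> C1_curve gamma -> 0 <= a < 1 -> 0 < k ->
  (forall t, a <= t <= 1 -> chart_dom c (gamma t) /\ forall v,
    (k * `|v|) ^+ 2 <= induced_metric eds_metric psi c (c (gamma t)) v v) ->
  ((k * `|c (gamma 1) - c (gamma a)|)%:E <= curve_length eds_metric psi gamma)%E.
Proof.
move=> ac [cg dg] /andP[a0 a1] k0 H; set u := c (gamma 1) - c (gamma a).
have [->|u0] := eqVneq u 0.
  by rewrite normr0 mulr0 integral_ge0 // => t _; rewrite lee_fin sqrtr_ge0.
have [i ui] := norm_eq_coord u0.
pose h (t : R) : R := k * (c (gamma t)) 0 i.
pose h' (t : R) : R := k * ((c \o gamma)^`()%classic t) 0 i.
have dh (t : R) : a <= t <= 1 -> is_derive (t : R) (1 : R) h (h' t).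
  move=> tab; have [ct _] := H t tab; have [dt _] := dg c t ac ct.
  have d1 : differentiable (c \o gamma) t by exact/derivable1_diffP.
  have := is_derive_mul (is_derive_const k t) (is_derive_coord (1 : R) i d1).
  by rewrite mul0r add0r /h' derive1E.
have ch' (t : R) : a <= t <= 1 -> {for t, continuous h'}.
  move=> tab; have [ct _] := H t tab; have [_ dt] := dg c t ac ct.
  exact: continuousM (@cst_continuous _ _ k t) (continuous_comp dt (@coord_continuous _ _ _ 0 i _)).
have ch (t : R) : a <= t <= 1 -> {for t, continuous h}.
  by move=> /dh d; apply/differentiable_continuous/derivable1_diffP/ex_derive.
have cwh' : {within `[a, 1], continuous h'}.
  by apply: continuous_in_subspaceT => t; rewrite inE /= in_itv /=; exact: ch'.
have FTC : (\int[lebesgue_measure]_(t in `[a, 1%R]) (h' t)%:E = (h 1)%:E - (h a)%:E)%E.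
  apply: continuous_FTC2 => //.
    split.
    - by move=> t; rewrite in_itv /= => /andP[at' t1]; apply: ex_derive; apply: dh; rewrite !ltW.
    - by apply: cvg_at_right_filter; apply: ch; rewrite lexx ltW.
    - by apply: cvg_at_left_filter; apply: ch; rewrite lexx ltW.
  move=> t; rewrite in_itv /= => /andP[at' t1]; rewrite derive1E.
  by apply: derive_val; apply: dh; rewrite !ltW.
have mh' : measurable_fun `[a, 1%R]%classic (EFin \o h').
  apply/measurable_EFinP; apply: subspace_continuous_measurable_fun => //.
have := le_abse_integral lebesgue_measure (measurable_itv `[a, 1]) mh'.
rewrite [X in (`|X|)%E]FTC -EFinB abse_EFin.
have -> : `|h 1 - h a| = k * `|u|.
  by rewrite ui /h -mulrBr normrM gtr0_norm // !mxE.
move=> /le_trans; apply; apply: le_integral_patch => /=.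
- by move=> t _; rewrite lee_fin sqrtr_ge0.
- by move=> t _; rewrite lee_fin.
move=> t; rewrite !in_itv /= => tab; split.
  by case/andP: tab => at' ->; rewrite (le_trans a0).
have [ct Hv] := H t tab; have [dt _] := dg c t ac ct.
have dp := is_derive_along_curve psi_hyp ac cg ct dt.
rewrite lee_fin derive1E (@derive_val _ _ _ _ _ _ _ dp).
have := Hv ((c \o gamma)^`()%classic t).
rewrite /induced_metric chart_mapK // => hv.
apply: (@le_trans _ _ (k * `|(c \o gamma)^`()%classic t|)).
  by rewrite normrM gtr0_norm // ler_pM2l // coord_le_norm.
have kw0 : 0 <= k * `|(c \o gamma)^`()%classic t| by rewrite mulr_ge0 // ltW.
have -> : k * `|(c \o gamma)^`()%classic t| = Num.sqrt ((k * `|(c \o gamma)^`()%classic t|) ^+ 2).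
  by rewrite sqrtr_sqr ger0_norm.
exact: ler_wsqrtr.
Qed.

(* The last parameter at which the curve is off the coordinate ball of radius r
   around p lies on its boundary. *)
Lemma last_exit (c : chart R m M) (p : M) (r : R) (gamma : R -> M) :
  chart_dom c p -> (forall z, `|z - c p| <= r -> chart_cod c z) -> 0 < r ->
  continuous gamma -> gamma 1 = p ->
  ~ (chart_dom c (gamma 0) /\ `|c (gamma 0) - c p| < r) ->
  exists a, [/\ 0 <= a < 1, r <= `|c (gamma a) - c p| &
    forall t, a <= t <= 1 -> chart_dom c (gamma t) /\ `|c (gamma t) - c p| <= r].
Proof.
move=> cp rcod r0 cg g1 out.
pose V := [set q | chart_dom c q /\ `|c q - c p| < r].
pose K := [set q | chart_dom c q /\ `|c q - c p| <= r].
have oV : open V.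
  rewrite openE => q [cq qr]; rewrite /interior /=.
  have h1 : \forall q' \near q, chart_dom c q'.
    exact: (open_nbhs_nbhs (conj (@chart_dom_open _ _ _ c) cq)).
  have h2 : \forall q' \near q, `|c q' - c q| < r - `|c q - c p|.
    have cq' : {for q, continuous c} by exact: chart_map_cts.
    have /cvgrPdist_lt h := cq'.
    have : 0 < r - `|c q - c p| by rewrite subr_gt0.
    by move=> /h; apply: filterS => q'; rewrite distrC.
  near=> q'; split; first by near: q'.
  rewrite -[c q' - c p](subrKA (c q)); apply: le_lt_trans (ler_normD _ _) _.
  by rewrite -ltrBrDr; near: q'.
(* Closed in all of M and not merely in the chart domain: [K] is the continuous image of a compact
   ball, and M is Hausdorff. *)
have cK : closed K.
  apply: compact_closed; first exact: manifold_hausdorff.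
  have -> : K = chart_inv c @` [set z | `|z - c p| <= r].
    apply/seteqP; split=> q /=.
      by move=> [cq qr]; exists (c q) => //; rewrite chart_mapK.
    move=> [z /= zr <-]; have cz := rcod z zr.
    by split; [exact: chart_inv_dom | rewrite chart_invK].
  apply: continuous_compact; last exact: compact_closed_dist.
  apply: continuous_in_subspaceT => z; rewrite inE /= => zr.
  by apply: chart_inv_cts; exact: rcod.
pose S := [set t : R | 0 <= t <= 1 /\ ~ V (gamma t)].
have S0 : S 0 by split=> //; rewrite lexx ler01.
have bS : has_ubound S by exists 1 => t [/andP[]].
have clS : closed S.
  have -> : S = `[0, 1]%classic `&` (gamma @^-1` (~` V)).
    by apply/seteqP; split=> t /=; rewrite in_itv.
  apply: closedI; first exact: itv_closed.
  by apply: closed_comp; [move=> t _; exact: cg | exact: open_closedC].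
have Sa : S (sup S) by apply: clS; apply: closure_sup => //; exists 0.
set a := sup S in Sa.
have later t : a < t <= 1 -> V (gamma t).
  move=> /andP[at' t1]; apply: contrapT => nV.
  have : t <= a by apply: ub_le_sup => //; split=> //; case: Sa => /andP[a0 _] _; rewrite t1 (le_trans a0) ?ltW.
  by rewrite leNgt at'.
case: Sa => /andP[a0 a1] nVa.
have lt1 : a < 1.
  rewrite lt_neqAle a1 andbT; apply/eqP => a1'; apply: nVa; rewrite a1' g1.
  by split=> //; rewrite subrr normr0.
(* Otherwise the curve would still be outside [K] just after [a], against [later]. *)
have Ka : K (gamma a).
  apply: contrapT => nK.
  have oK : open (~` K) by exact: closed_openC.
  have : \forall t \near a, (~` K) (gamma t).
    by apply: cg; apply: open_nbhs_nbhs.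
  move=> /nbhs_distP [d d0 Hd].
  pose t := Num.min 1 (a + d / 2).
  have at' : a < t by rewrite lt_min lt1 ltrDl divr_gt0.
  have t1 : t <= 1 by rewrite ge_min lexx.
  have td : t <= a + d / 2 by rewrite ge_min lexx orbT.
  apply: (Hd t).
    by rewrite gtr0_norm ?subr_gt0 //; lra.
  have [ct cr] : V (gamma t) by apply: later; rewrite at'.
  by split=> //; exact: ltW.
exists a; split.
- by rewrite a0.
- by rewrite leNgt; apply/negP => h; apply: nVa; split=> //; case: Ka.
- move=> t /andP[]; rewrite le_eqVlt => /predU1P[<- _|at' t1]; first exact: Ka.
  by have [|ct cr] := later t; [rewrite at' | split=> //; exact: ltW].
Unshelve. all: by end_near. Qed.

(** A curve to [p] from outside [U] has a last part that crosses a coordinate ball of radius [r]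
    around [p], where its length is at least [k * r]. Thus convergence for the induced distance
    implies convergence in the topology of M. *)
Lemma nbhs_induced_dist (p : M) (U : set M) : nbhs p U ->
  exists2 e : R, 0 < e & forall q, (induced_dist eds_metric psi q p < e%:E)%E -> U q.
Proof.
move=> nU; have [c ac cp] := atlas_cover p.
have cx := chart_map_cod cp.
have [k k0 kB] := induced_metric_near psi_hyp ac cx.
have cod_near : \forall z \near c p, chart_cod c z.
  exact: (open_nbhs_nbhs (conj (@chart_cod_open _ _ _ c) cx)).
have U_near : \forall z \near c p, U (chart_inv c z).
  by have := chart_inv_cts cx; apply; rewrite chart_mapK.
have [d d0 Hd] : exists2 d : R, 0 < d & forall z, `|z - c p| < d ->
    [/\ chart_cod c z, U (chart_inv c z) & forall v,
    (k * `|v|) ^+ 2 <= induced_metric eds_metric psi c z v v].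
  apply/nbhs_distP; near=> z; split; [by near: z | by near: z |].
  by move=> v; move: v; near: z.
pose r := d / 2.
have r0 : 0 < r by rewrite divr_gt0.
have rd z : `|z - c p| <= r -> `|z - c p| < d by rewrite /r => ?; lra.
exists (k * r); first by rewrite mulr_gt0.
move=> q; apply: contraPP => nUq; apply/negP; rewrite -leNgt.
apply: le_ereal_inf_tmp => _ [gamma [C1g g0 g1] <-].
have [|||a [a01 ra Ha]] := @last_exit c p r gamma cp _ r0 _ g1 _.
- by move=> z /rd /Hd[].
- by case: C1g.
- rewrite g0 => -[cq qr]; apply: nUq; rewrite -(chart_mapK cq).
  by have [] := Hd (c q) (rd _ (ltW qr)).
apply: le_trans (@curve_length_ge c gamma a k ac C1g a01 k0 _).
  by rewrite lee_fin ler_pM2l // g1 distrC.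
by move=> t /Ha [ct /rd /Hd [_ _ h]].
Unshelve. all: by end_near. Qed.

End small_distance.

(** * Global sections and the minimum of the barrier *)

Section sections_on_large_balls.
Context {R : realType} {m : nat} {M : smooth_manifold R m}.
Variable psi : M -> 'rV[R]_m.+1.
Hypothesis psi_hyp : eds_spacelike_hypersurface psi.
Variable T : R.
Hypothesis time_le : forall p, time (psi p) <= T.
Hypothesis complete : induced_complete eds_metric psi.

Local Notation F := (space psi).
Let F_C1 := @space_C1 _ _ _ _ psi_hyp.
Let F_inj := @space_inj _ _ _ _ psi_hyp.
Local Notation B x d := [set w : 'rV[R]_m | `|w - x| < d].

Let cball x d : segment_closed (B x d). Proof. exact: segment_closed_ball. Qed.

Let open_ball x d : open (B x d). Proof. exact: open_dist_lt. Qed.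

(** The points [u k] tend to [y] along a radius, strictly inside the ball. By [dist_section_le]
    their images under [s] form a Cauchy sequence, so completeness gives the limit [q], and
    continuity of F places it over [y]. *)
Lemma section_limit x d s y : section_on F (B x d) s -> 0 < d -> `|y - x| <= d ->
  exists (u : nat -> 'rV[R]_m) (q : M),
  [/\ forall k, B x d (u k), F q = y,
      forall e, 0 < e -> \forall k \near \oo, `|u k - y| < e &
      forall U, nbhs q U -> \forall k \near \oo, U (s (u k))].
Proof.
move=> Ss d0 yd; pose u k : 'rV[R]_m := k.+1%:R^-1 *: (x - y) + y.
have ux k : B x d (u k).
  rewrite /u /=; have -> : k.+1%:R^-1 *: (x - y) + y - x = (1 - k.+1%:R^-1) *: (y - x).
    by apply/rowP => j; rewrite !mxE; ring.
  have k1 : (k.+1%:R^-1 : R) <= 1 by rewrite invf_le1 ?ler1n // ltr0n.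
  have k0 : 0 < (k.+1%:R^-1 : R) by rewrite invr_gt0 ltr0n.
  rewrite normrZ ger0_norm ?subr_ge0 //.
  have [->|yx] := eqVneq `|y - x| 0; first by rewrite mulr0.
  have n0 : 0 < `|y - x| by rewrite lt_def yx normr_ge0.
  by apply: lt_le_trans yd; rewrite mulrBl mul1r gtrBl mulr_gt0.
have uy (e : R) : 0 < e -> \forall k \near \oo, `|u k - y| < e.
  move=> e0; have B0 : 0 < 1 + `|x - y| by rewrite ltr_pwDl.
  have := near_infty_natSinv_lt (PosNum (divr_gt0 e0 B0)).
  apply: filterS => k /= h.
  rewrite /u addrK normrZ ger0_norm ?invr_ge0 ?ler0n //.
  move: h; rewrite ltr_pdivlMr // => h; apply: le_lt_trans h.
  by rewrite ler_wpM2l ?invr_ge0 ?ler0n // lerDr.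
have [C C0 HC] := dist_section_le psi_hyp time_le.
have [|q Hq] := complete (u := s \o u).
  move=> e e0; have e2 : 0 < e / (2 * C) by rewrite divr_gt0 // mulr_gt0.
  have [k _ Hk] := uy _ e2; exists k => i j ki kj.
  apply: le_lt_trans (HC _ s _ _ (@cball x d) Ss (ux i) (ux j)) _.
  rewrite lte_fin -ltr_pdivlMl //.
  rewrite -[u j - u i](subrKA y); apply: le_lt_trans (ler_normD _ _) _.
  rewrite [`|y - _|]distrC.
  have := Hk i ki; have := Hk j kj => /= h1 h2.
  have -> : C^-1 * e = e / (2 * C) + e / (2 * C) by field; rewrite gt_eqF.
  exact: ltrD.
have conv (U : set M) : nbhs q U -> \forall k \near \oo, U (s (u k)).
  move=> /(nbhs_induced_dist psi_hyp) [e e0 He]; have [k Hk] := Hq e e0.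
  by exists k => // i /= ki; apply: He; exact: Hk.
exists u, q; split=> //.
apply/eqP; rewrite -subr_eq0 -normr_le0; apply/ler_addgt0Pl => e e0; rewrite addr0.
have e2 : 0 < e / 2 by rewrite divr_gt0.
have Fc := @local_diffeo_continuous _ _ _ _ F_C1 q.
have /conv nF : nbhs q [set p | `|F q - F p| < e / 2].
  by have /cvgrPdist_lt := Fc; apply.
near \oo => k.
have h1 : `|F q - F (s (u k))| < e / 2 by near: k.
have h2 : `|u k - y| < e / 2 by near: k; exact: uy.
rewrite (Ss _ (ux k)).1 in h1.
rewrite -[F q - y](subrKA (u k)); apply: le_trans (ler_normD _ _) _.
by rewrite [e]splitr lerD // ltW.
Unshelve. all: by end_near. Qed.

(** The local section at the limit point [q] agrees with [s] at [u k] for large [k], hence on the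
    convex overlap of the two balls. *)
Lemma section_near_closed_ball x d s y : section_on F (B x d) s -> 0 < d ->
  `|y - x| <= d -> exists2 e : R, 0 < e & exists t, section_on F (B y e) t /\
  forall w, B x d w -> B y e w -> t w = s w.
Proof.
move=> Ss d0 yd; have [u [q [ux Fq uy uq]]] := section_limit Ss d0 yd.
have [e [t [e0 St tF]]] := local_section F_C1 F_inj q.
rewrite Fq in St; exists e => //; exists t; split=> // w wx wy.
near \oo => k.
have uke : B y e (u k) by near: k; exact: uy.
have tk : t (u k) = s (u k).
  by rewrite -{1}(Ss _ (ux k)).1; near: k; exact: (uq _ tF).
have S1 : section_on F (B x d `&` B y e) t by apply: section_onS St; exact: subIsetr.
have S2 : section_on F (B x d `&` B y e) s by apply: section_onS Ss; exact: subIsetl.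
exact: (section_unique F_C1 F_inj (segment_closedI (@cball x d) (@cball y e)) S1 S2
  (conj (ux k) uke) (conj wx wy) tk).
Unshelve. all: by end_near. Qed.

(** A Lebesgue number argument: a radius that works at [y] works, when halved, at all points near
    [y], and the closed ball is compact. *)
Lemma section_near_closed_ball_uniform x d s : section_on F (B x d) s -> 0 < d ->
  exists2 e : R, 0 < e & forall y, `|y - x| <= d ->
  exists t, section_on F (B y e) t /\
    forall w, B x d w -> B y e w -> t w = s w.
Proof.
move=> Ss d0.
pose P (e : R) (y : 'rV[R]_m) := exists t, section_on F (B y e) t /\
    forall w, B x d w -> B y e w -> t w = s w.
have /compact_near_coveringP cov := @compact_closed_dist R m x d.
have nP : \forall e \near (0 : R)^'+, [set y | `|y - x| <= d] `<=` P e.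
  apply: cov => y /= yd; have [e e0 [t [St ts]]] := section_near_closed_ball Ss d0 yd.
  have e2 : 0 < e / 2 by rewrite divr_gt0.
  have n1 : \forall y' \near y, `|y' - y| < e / 2 by apply/nbhs_distP; exists (e / 2).
  have n2 : \forall k \near (0 : R)^'+, k < e / 2 by exact: nbhs_right_lt.
  near=> y' k; exists t.
  have sub : B y' k `<=` B y e.
    move=> w /= wy'; rewrite -[w - y](subrKA y'); apply: le_lt_trans (ler_normD _ _) _.
    rewrite [e]splitr; apply: ltrD; last by near: y'.
    by apply: lt_trans wy' _; near: k.
  split; first exact: section_onS St.
  by move=> w wx /sub wy; exact: ts.
near (0 : R)^'+ => e; exists e; first by near: e; exact: nbhs_right_gt.
by near: e.
Unshelve. all: by end_near. Qed.

(** The local sections around the points of the closed ball are glued to one on a larger ball: at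
    [z] the section around a nearby point of the small ball is used. *)
Lemma section_extends x d s : section_on F (B x d) s -> 0 < d ->
  exists d' s', [/\ d < d', section_on F (B x d') s' & s' x = s x].
Proof.
move=> Ss d0; have [e e0 He] := section_near_closed_ball_uniform Ss d0.
have [t Ht] : exists t : 'rV[R]_m -> 'rV[R]_m -> M, forall y, `|y - x| <= d ->
    section_on F (B y e) (t y) /\ forall w, B x d w -> B y e w -> t y w = s w.
  have [|t Ht] := @choice _ _ (fun y t => `|y - x| <= d ->
    section_on F (B y e) t /\ forall w, B x d w -> B y e w -> t w = s w) _.
    move=> y; have [yd|] := boolP (`|y - x| <= d); last by exists s.
    by have [t Ht] := He y yd; exists t.
  by exists t.
have e2 : 0 < e / 2 by rewrite divr_gt0.
pose d' := d + e / 2; have d'0 : 0 < d' by rewrite addr_gt0.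
pose k := d / d'; have k0 : 0 < k by rewrite divr_gt0.
have kd' : k * d' = d by rewrite divfK // gt_eqF.
have k1 : k < 1 by rewrite ltr_pdivrMr // mul1r ltrDl.
(* z lies within e / 2 of its image c z under a contraction of the large ball
   onto the small one *)
pose c (z : 'rV[R]_m) := x + k *: (z - x).
have cx z : c z - x = k *: (z - x) by rewrite /c addrC addKr.
have zc z : z - c z = (1 - k) *: (z - x).
  by apply/rowP => j; rewrite !mxE; ring.
have cz_in z : B x d' z -> B x d (c z).
  by move=> /= zd; rewrite cx normrZ gtr0_norm // -kd' ltr_pM2l.
have zc_le z : B x d' z -> `|z - c z| < e / 2.
  move=> /= zd; rewrite zc normrZ gtr0_norm ?subr_gt0 //.
  have <- : (1 - k) * d' = e / 2 by rewrite mulrBl mul1r kd' /d' addrC addKr.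
  by rewrite ltr_pM2l // subr_gt0.
have cc z z' : c z' - c z = k *: (z' - z).
  by apply/rowP => j; rewrite !mxE; ring.
(* Both local sections equal [s] at [c z'], which lies in the small ball and in both [e]-balls; so
   they agree on the convex overlap, which contains [z']. *)
have agree z z' : B x d' z -> B x d' z' -> `|z' - z| < e / 2 -> t (c z') z' = t (c z) z'.
  move=> zd zd' zz'.
  have [T1 a1] := Ht (c z) (ltW (cz_in _ zd)).
  have [T2 a2] := Ht (c z') (ltW (cz_in _ zd')).
  have S1 : section_on F (B (c z) e `&` B (c z') e) (t (c z)).
    by apply: section_onS T1; exact: subIsetl.
  have S2 : section_on F (B (c z) e `&` B (c z') e) (t (c z')).
    by apply: section_onS T2; exact: subIsetr.
  have cc' : B (c z) e (c z').
    rewrite /= cc normrZ gtr0_norm //; apply: (@lt_trans _ _ (e / 2)); last by lra.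
    by apply: le_lt_trans zz'; rewrite ler_piMl // ltW.
  have c'c' : B (c z') e (c z') by rewrite /= subrr normr0.
  have z'c : B (c z) e z'.
    rewrite /= -[z' - c z](subrKA z); apply: le_lt_trans (ler_normD _ _) _.
    by rewrite [e]splitr ltrD // zc_le.
  have z'c' : B (c z') e z' by apply: lt_trans (zc_le _ zd') _; lra.
  apply/esym; apply: (section_unique F_C1 F_inj (segment_closedI (@cball _ _) (@cball _ _)) S1 S2
    (conj cc' c'c') (conj z'c z'c')).
  by rewrite a1 ?a2 //; exact: cz_in.
exists d', (fun z => t (c z) z); split; first by rewrite ltrDl.
- move=> z zd; have [T1 _] := Ht (c z) (ltW (cz_in _ zd)).
  have zce : B (c z) e z by apply: lt_trans (zc_le _ zd) _; lra.
  split; first exact: (T1 z zce).1.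
  have near_z : \forall z' \near z, t (c z) z' = t (c z') z'.
    have n1 : \forall z' \near z, B x d' z' by apply: open_nbhs_nbhs; split.
    have n2 : \forall z' \near z, `|z' - z| < e / 2 by apply/nbhs_distP; exists (e / 2).
    by near=> z'; apply/esym/agree => //; near: z'.
  exact: (cvg_trans (near_eq_cvg near_z) (T1 z zce).2).
- have -> : c x = x by rewrite /c subrr scaler0 addr0.
  have [|_] := Ht x; first by rewrite subrr normr0 ltW.
  by apply; rewrite /= subrr normr0.
Unshelve. all: by end_near. Qed.

(** Continuation in the radius. If the admissible radii had a finite supremum, the sections over
    smaller balls would glue to one over the ball of that radius, and [section_extends] would exceed
    it. *)
Lemma section_on_ball q d : 0 < d -> exists s, section_on F (B (F q) d) s /\ s (F q) = q.
Proof.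
move=> d0; set x := F q.
pose E := [set e : R | 0 < e /\ exists s, section_on F (B x e) s /\ s x = q].
have Edown e e' : 0 < e' -> e' <= e -> E e -> E e'.
  move=> e'0 e'e [_ [s [Ss sx]]]; split=> //; exists s; split=> //.
  by apply: section_onS Ss => w /= /lt_le_trans; apply.
have [e1 Ee1] : exists e, E e.
  have [e [s [e0 Ss sF]]] := local_section F_C1 F_inj q.
  by exists e; split=> //; exists s; split; [exact: Ss | exact: (nbhs_singleton sF)].
have [ubE|nub] := pselect (has_ubound E); last first.
  suff [_] : E d by [].
  apply: contrapT => nEd; apply: nub; exists d => e Ee.
  by rewrite leNgt; apply/negP => de; apply: nEd; apply: Edown Ee => //; exact: ltW.
exfalso; set D := sup E.
have D0 : 0 < D by apply: lt_le_trans (ub_le_sup ubE Ee1); case: Ee1.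
have ED e : 0 < e -> e < D -> E e.
  move=> e0 eD; have De : 0 < D - e by rewrite subr_gt0.
  have [|e' Ee'] := @sup_adherent _ E (D - e) De; first by split=> //; exists e1.
  by rewrite -/D subKr => /ltW ee'; exact: Edown Ee'.
have [S HS] : exists S : R -> 'rV[R]_m -> M, forall e, 0 < e -> e < D ->
    section_on F (B x e) (S e) /\ S e x = q.
  have [|S HS] := @choice _ _ (fun e s => 0 < e -> e < D ->
    section_on F (B x e) s /\ s x = q) _.
    move=> e; have [/andP[e0 eD]|ne] := boolP (0 < e < D).
      by have [_ [s Hs]] := ED e e0 eD; exists s.
    by exists (fun=> q) => e0 eD; rewrite e0 eD in ne.
  by exists S.
(* Midway between |w - x| and [D]: an admissible radius whose ball contains [w] and depends on [w]
   alone. *)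
pose r (w : 'rV[R]_m) := (`|w - x| + D) / 2.
have r0 w : 0 < r w by rewrite divr_gt0 // ltr_wpDl.
have rD w : B x D w -> r w < D by rewrite /r /=; lra.
have wr w : B x D w -> `|w - x| < r w by rewrite /r /=; lra.
have agree w w' : B x D w -> B x D w' -> `|w' - x| < r w -> S (r w') w' = S (r w) w'.
  move=> wD w'D w'r.
  have [S1 q1] := HS _ (r0 w) (rD _ wD); have [S2 q2] := HS _ (r0 w') (rD _ w'D).
  have S1' : section_on F (B x (r w) `&` B x (r w')) (S (r w)).
    by apply: section_onS S1; exact: subIsetl.
  have S2' : section_on F (B x (r w) `&` B x (r w')) (S (r w')).
    by apply: section_onS S2; exact: subIsetr.
  apply/esym; apply: (section_unique F_C1 F_inj (segment_closedI (@cball _ _) (@cball _ _)) S1' S2'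
    (a := x)); last by rewrite q1 q2.
    by split; rewrite /= subrr normr0.
  by split=> //; exact: wr.
have Sx : section_on F (B x D) (fun w => S (r w) w).
  move=> w wD; have [S1 _] := HS _ (r0 w) (rD _ wD).
  split; first exact: (S1 w (wr _ wD)).1.
  have near_w : \forall w' \near w, S (r w) w' = S (r w') w'.
    have n1 : \forall w' \near w, B x D w' by apply: open_nbhs_nbhs; split.
    have n2 : \forall w' \near w, B x (r w) w'.
      by apply: open_nbhs_nbhs; split=> //; exact: wr.
    by near=> w'; apply/esym/agree => //; near: w'.
  exact: (cvg_trans (near_eq_cvg near_w) (S1 w (wr _ wD)).2).
have [D' [s' [DD' Ss' s'x]]] := section_extends Sx D0.
have : E D'.
  split; first exact: lt_trans DD'.
  exists s'; split=> //; rewrite s'x; apply: (HS _ (r0 x) _).2.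
  by apply: rD; rewrite /= subrr normr0.
by move=> /(ub_le_sup ubE); rewrite -/D leNgt DD'.
Unshelve. all: by end_near. Qed.

End sections_on_large_balls.

(** * Existence of a contact point *)

Section barrier_attains_a_minimum.
Context {R : realType} {m : nat} {M : smooth_manifold R m}.
Variable psi : M -> 'rV[R]_m.+1.
Hypothesis psi_hyp : eds_spacelike_hypersurface psi.
Variable T : R.
Hypothesis time_le : forall p, time (psi p) <= T.
Hypothesis complete : induced_complete eds_metric psi.

Lemma barrier_continuous (r : R) (y : 'rV[R]_m) (z : 'rV[R]_m.+1) : 0 < time z ->
  {for z, continuous (barrier r y)}.
Proof.
move=> z0.
have c1 : {for z, continuous (fun z : 'rV[R]_m.+1 => time z `^ (3^-1))}.
  have d1 := is_derive1_powR (3^-1) z0.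
  have c2 : {for time z, continuous (fun t => t `^ (3^-1))}.
    exact/differentiable_continuous/derivable1_diffP/(ex_derive (is_derive := d1)).
  exact: (continuous_comp (@coord_continuous _ _ _ 0 0 z) c2).
have c3 : {for z, continuous (fun z : 'rV[R]_m.+1 => r ^+ 2 + \sum_i (z 0 (lift ord0 i) - y 0 i) ^+ 2)}.
  have c4 : {for z, continuous (fun z : 'rV[R]_m.+1 => \sum_i (z 0 (lift ord0 i) - y 0 i) ^+ 2)}.
    apply: (@cvg_sumr _ _ (nbhs z)) => i.
    have c5 : {for z, continuous (fun z : 'rV[R]_m.+1 => z 0 (lift ord0 i) - y 0 i)}.
      exact: (continuousB (@coord_continuous _ _ _ 0 (lift ord0 i) z) (@cst_continuous _ _ (y 0 i) z)).
    exact: (continuousM c5 c5).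
  exact: (continuousD (@cst_continuous _ _ (r ^+ 2) z) c4).
have c6 := continuous_comp c3 (@sqrt_continuous R _).
exact: (continuousD (continuousM (@cst_continuous _ _ (3 : R) z) c1) c6).
Qed.

Lemma barrier_local_min (r : R) : exists (y : 'rV[R]_m) (p : M),
  \forall q \near p, barrier r y (psi p) <= barrier r y (psi q).
Proof.
have tpos p : 0 < time (psi p) by case: psi_hyp => + _ _; apply.
have [p0 _] := manifold_nonempty M.
pose F := space psi; pose y := F p0; exists y.
pose Phi p := barrier r y (psi p).
have Phi_ge p : `|F p - y| <= Phi p.
  rewrite /Phi /barrier; apply: norm_le_coord => [|i].
    by rewrite addr_ge0 ?sqrtr_ge0 // mulr_ge0 ?powR_ge0.
  rewrite -[leLHS]add0r; apply: lerD; first by rewrite mulr_ge0 ?powR_ge0.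
  rewrite -sqrtr_sqr ler_wsqrtr // (bigD1 i) //= !mxE addrCA lerDl.
  by rewrite addr_ge0 ?sqr_ge0 // sumr_ge0 // => j _; rewrite sqr_ge0.
pose D := Phi p0 + 1.
have D0 : 0 < D by rewrite ltr_wpDl // (le_trans _ (Phi_ge p0)).
(* The section is taken over a ball of twice the radius, so that it is continuous on the closed ball
   of radius [D]. *)
have D2 : 0 < 2 * D by rewrite mulr_gt0.
have [s [Ss sy]] := section_on_ball psi_hyp time_le complete p0 D2.
have inB w : `|w - y| <= D -> `|w - y| < 2 * D by lra.
have cPhi : {within [set w : 'rV[R]_m | `|w - y| <= D], continuous (Phi \o s)}.
  apply: continuous_in_subspaceT => w; rewrite inE /= => wD.
  have cs := (Ss w (inB _ wD)).2.
  have cpsi : {for s w, continuous psi}.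
    by apply: continuous_in_charts => c x; exact: chart_differentiable.
  have h1 := continuous_comp cs cpsi.
  exact: (continuous_comp h1 (barrier_continuous (tpos _))).
have [|w] := @EVT_min_rV R m (Phi \o s) _ _ (@compact_closed_dist R m y D) cPhi.
  by exists y; rewrite /= subrr normr0 ltW.
rewrite inE /= => wD wmin; exists (s w).
have wy : Phi (s w) <= Phi p0.
  by rewrite -sy; apply: wmin; rewrite inE /= subrr normr0 ltW.
have Fw : F (s w) = w by exact: (Ss w (inB _ wD)).1.
(* The minimizer is strictly interior because its value is at most [Phi p0], which is less than
   [D]. *)
have wD' : `|F (s w) - y| < D.
  by apply: le_lt_trans (Phi_ge _) _; apply: le_lt_trans wy _; rewrite ltrDl.
have oB : open [set w : 'rV[R]_m | `|w - y| < 2 * D].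
  exact: open_dist_lt.
(* Every point of M near [s w] is thus in the image of the section, so the minimum over the ball is
   compared with all of them. *)
have sF : \forall q \near s w, s (F q) = q.
  apply: (section_local_inverse (@space_C1 _ _ _ _ psi_hyp) (@space_inj _ _ _ _ psi_hyp) oB Ss).
    by apply: inB; exact: ltW.
  exact: (congr1 s Fw).
have nF : \forall q \near s w, `|F q - y| < D.
  have Fc := @local_diffeo_continuous _ _ _ _ (@space_C1 _ _ _ _ psi_hyp) (s w).
  apply: (Fc [set z | `|z - y| < D]); apply: open_nbhs_nbhs; split; [exact: open_dist_lt | exact: wD'].
near=> q.
have qD : `|F q - y| < D by near: q.
rewrite -(near sF q) //.
by apply: wmin; rewrite inE /= ltW.
Unshelve. all: by end_near. Qed.

End barrier_attains_a_minimum.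

(** * The contradiction at the contact point *)

Theorem corollary16 (R : realType) (m : nat) (hm : (2 <= m)%N) :
  ~ exists (M : smooth_manifold R m) (psi N : M -> 'rV[R]_m.+1) (H : R),
      [/\ eds_spacelike_hypersurface psi,
          eds_gauss_map psi N,
          induced_complete eds_metric psi,
          (forall p : M, has_mean_curvature eds_metric psi N p H) /\ H <= 0 &
          bounded_away_from_future_infinity psi].
Proof.
case=> M [psi [N [H [psi_hyp [[sN normal unit] ndt] complete [mean H0] [T0 T0_ub]]]]].
have time_le p : time (psi p) <= T0 by apply: T0_ub; exists p.
have tpos p : 0 < time (psi p) by case: psi_hyp => + _ _; apply.
have [p0 _] := manifold_nonempty M.
have T_gt0 : 0 < T0 := lt_le_trans (tpos p0) (time_le p0).
(* With this choice 1/r = 1 / (2 T0^(1/3)) < 2 / (3 T0^(1/3)), which is at most rho' at every time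
   up to [T0]. *)
pose r : R := 2 * T0 `^ (3^-1).
have r0 : 0 < r by rewrite mulr_gt0 ?powR_gt0.
have [y [p pmin]] := barrier_local_min psi_hyp time_le complete r.
have [c ac cp] := atlas_cover p.
have [A shape HA] := mean p c ac cp.
have m0 : (0 < m)%N by exact: leq_trans hm.
have pE : chart_inv c (c p) = p by exact: chart_mapK.
have cx := chart_map_cod cp.
(* Since H = - tr A / m, the assumption [H <= 0] means that the trace is nonnegative. *)
suff trA : \tr A < 0.
  have : 0 <= m%:R^-1 * \tr A by rewrite -oppr_le0 -HA.
  by rewrite pmulr_rge0 ?invr_gt0 ?ltr0n // leNgt trA.
apply: (@barrier_contact R m (chart_cod c) (psi \o chart_inv c) (N \o chart_inv c) (c p) y A r) => //.
- exact: chart_cod_open.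
- exact: chart_smooth.
- exact: sN.
- by move=> z _; exact: tpos.
- by move=> z v cz; exact: (unit c z v).
- by rewrite /= pE.
- by move=> v v0; case: psi_hyp => _ _ /(_ c (c p) v ac cx v0).
- rewrite /= pE; have q0 : 0 < time (psi p) `^ (3^-1) by rewrite powR_gt0.
  have qT : time (psi p) `^ (3^-1) <= T0 `^ (3^-1).
    by apply: ge0_ler_powR; rewrite ?invr_ge0 // nnegrE ltW.
  rewrite /r ltr_pdivlMr ?mulr_gt0 // mulrC ltr_pdivrMr ?mulr_gt0 ?powR_gt0 //.
  lra.
- rewrite /= pE.
  have cc : {for c p, continuous (chart_inv c)} := chart_inv_cts cx.
  apply: (cc [set q | barrier r y (psi p) <= barrier r y (psi q)]).
  by rewrite pE.
Qed.
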